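(* Let $\nu = \frac12[\delta_{-1}+\delta_{1}]$ be the symmetric Bernoulli distribution, with Stieltjes transform $G_\nu(z) = \frac{z}{z^2-1}$, and let $\lambda>0$ be real. There exists a probability measure $\mu$ on $\mathbb{R}$ such that $$\int_{\mathbb{R}} \frac{1}{(z-x)^{\lambda}}\,\mu(dx) = \left[\frac{z}{z^2-1}\right]^{\lambda}\qquad\text{for all } z\in\mathbb{C} \text{ with } \Im(z)>0$$ if and only if $\lambda\geq 1$.
   Context: All powers are principal powers (note that $\Im(z)>0$ implies $\Im\big(z/(z^2-1)\big)<0$). The left-hand side is the generalized Stieltjes transform $G_{\lambda,\mu}(z)$ of $\mu$. *)

(* Defs.v *)
From HB Require Import structures.
From mathcomp Require Import all_boot all_order all_algebra.
From mathcomp Require Import complex.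
From mathcomp Require Import all_classical all_reals all_analysis.

Set Implicit Arguments.
Unset Strict Implicit.
Unset Printing Implicit Defensive.

Import Order.TTheory GRing.Theory Num.Theory.
Import numFieldNormedType.Exports.

Local Open Scope classical_set_scope.
Local Open Scope ring_scope.

Section ComplexPower.
Context {R : realType}.

Definition cexp (w : R[i]) : R[i] :=
  ((expR (complex.Re w) * cos (complex.Im w)) +i*
   (expR (complex.Re w) * sin (complex.Im w)))%C.

(* Principal argument, in ]-pi, pi] for z != 0: a negative real has argument
   acos (-1) = pi.  The value at 0 is irrelevant. *)
Definition carg (z : R[i]) : R :=
  let t := acos (complex.Re z / Normc.normc z) in
  if complex.Im z < 0 then - t else t.

Definition clog (z : R[i]) : R[i] := (ln (Normc.normc z) +i* carg z)%C.

(* Principal power z ^ l with a real exponent; at z = 0 it follows the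
   convention of powR. *)
Definition cpow (z : R[i]) (l : R) : R[i] :=
  if z == 0 then (l == 0)%:R else cexp ((l%:C)%C * clog z).

End ComplexPower.

Section StieltjesTransform.
Context {R : realType}.

(* Real and imaginary parts are integrated separately.  Rintegral is total;
   the integrands below are bounded and continuous when 0 < Im z and 0 < l, hence
   integrable against every finite measure. *)
Definition cintegral (mu : {measure set (measurableTypeR R) -> \bar R})
    (f : R -> R[i]) : R[i] :=
  (Rintegral mu setT (fun x => complex.Re (f x)) +i*
   Rintegral mu setT (fun x => complex.Im (f x)))%C.

Definition stieltjes (mu : {measure set (measurableTypeR R) -> \bar R})
    (z : R[i]) : R[i] :=
  cintegral mu (fun x => 1 / (z - (x%:C)%C)).

Definition gen_stieltjes (l : R)
    (mu : {measure set (measurableTypeR R) -> \bar R}) (z : R[i]) : R[i] :=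
  cintegral mu (fun x => 1 / cpow (z - (x%:C)%C) l).

End StieltjesTransform.

Section SymmetricBernoulli.
Context (R : realType).

Definition sym_bernoulli : set (measurableTypeR R) -> \bar R :=
  mscale (2^-1)%:nng
    (measure_add \d_(-1 : measurableTypeR R) \d_(1 : measurableTypeR R)).

HB.instance Definition _ := Measure.on sym_bernoulli.

Local Open Scope ereal_scope.

Let sym_bernoulli_setT : sym_bernoulli setT = 1.
Proof.
have -> : sym_bernoulli setT = (2^-1%R)%:E *
    (\d_(-1 : measurableTypeR R)%R setT + \d_(1 : measurableTypeR R)%R setT).
  by rewrite -measure_addE.
rewrite !diracT -EFinD -EFinM.
by rewrite -[(1 + 1)%R]/(2%:R)%R mulVf// pnatr_eq0.
Qed.

HB.instance Definition _ :=
  Measure_isProbability.Build _ _ _ sym_bernoulli sym_bernoulli_setT.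

End SymmetricBernoulli.

Arguments sym_bernoulli : clear implicits.

(* Main.v *)
Require Import Defs.
From HB Require Import structures.
From mathcomp Require Import all_boot all_order all_algebra.
From mathcomp Require Import complex.
From mathcomp Require Import all_classical all_reals all_analysis.
From mathcomp Require Import measurable_realfun ring lra.

Set Implicit Arguments.
Unset Strict Implicit.
Unset Printing Implicit Defensive.

Import Order.TTheory GRing.Theory Num.Theory.
Import numFieldNormedType.Exports.

Local Open Scope classical_set_scope.
Local Open Scope ring_scope.

(** Write F z = z / (z ^ 2 - 1) and mean by the transform of order l of a
    probability measure mu the integral of (z - x)^(-l) against mu.

    Necessity.  At z = 1 + ie and z = -1 + ie the modulus of F z is at least
    1 / (2 e), while e^l times the sum of the two kernels |z - x|^(-l) is at
    most 1 + e^l for every real x, because x is at distance at least 1 from 1 or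
    from -1.  Integrating gives 2 * 2^(-l) <= 1 + e^l for all e > 0, that is
    l >= 1 (transform_exponent_ge1): otherwise mu would have two atoms of total
    mass larger than 1.

    Sufficiency rests on two facts.

    - Products (is_transform_mul).  If H is a transform of order s and A one of
      order 1, then H * A is one of order s + 1: with X and Y independent with
      these transforms and T an independent Beta(s, 1) variable, it is the
      transform of Y + T (X - Y), since the mean of (z - Y - T (X - Y))^(-s-1)
      over T is (z - X)^(-s) / (z - Y).

    - Fractional powers (is_transform_power).  For 0 < s < 1 and e = 1 or -1,
      (z / (z + e))^s / (z - e) is a transform of order 1.  This comes from the
      representation of eta^(-s) as a constant times the integral of
      v^(-s) / (v + eta) over v > 0, applied to eta = (z + e) / z, and a partial
      fraction decomposition with positive weights.  After v = e^x the
      integral is one over the real line of a logistic kernel at x - clog eta,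
      and a shift of the contour removes clog eta (Rintegral_contour_shift).

    F itself is the transform of order 1 of the symmetric Bernoulli law.  For
    l = 1 + s with 0 < s < 1 the power F^l is the mean over e = 1, -1 of
    (z - e)^(-s) * (z / (z + e))^s / (z - e), hence a transform by the two facts
    (is_transform_base); larger exponents follow by repeated multiplication
    by F. *)

(** * The complex exponential, logarithm and powers *)

Section ComplexElementary.
Context {R : realType}.
Implicit Types (z w : R[i]) (l x : R).

Lemma complexP z w : complex.Re z = complex.Re w ->
  complex.Im z = complex.Im w -> z = w.
Proof. by case: z w => [a b] [c d] /= -> ->. Qed.

Lemma ReD z w : complex.Re (z + w) = complex.Re z + complex.Re w.
Proof. by case: z w => [a b] [c d]. Qed.

Lemma ImD z w : complex.Im (z + w) = complex.Im z + complex.Im w.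
Proof. by case: z w => [a b] [c d]. Qed.

Lemma ReN z : complex.Re (- z) = - complex.Re z. Proof. by case: z. Qed.

Lemma ImN z : complex.Im (- z) = - complex.Im z. Proof. by case: z. Qed.

Lemma ReM z w : complex.Re (z * w) =
  complex.Re z * complex.Re w - complex.Im z * complex.Im w.
Proof. by case: z w => [a b] [c d]. Qed.

Lemma ImM z w : complex.Im (z * w) =
  complex.Re z * complex.Im w + complex.Im z * complex.Re w.
Proof. by case: z w => [a b] [c d]. Qed.

Lemma ReMc x z : complex.Re ((x%:C)%C * z) = x * complex.Re z.
Proof. by rewrite ReM /= mul0r subr0. Qed.

Lemma ImMc x z : complex.Im ((x%:C)%C * z) = x * complex.Im z.
Proof. by rewrite ImM /= mul0r addr0. Qed.

Lemma normc_sqr z :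
  Normc.normc z ^+ 2 = complex.Re z ^+ 2 + complex.Im z ^+ 2.
Proof. by case: z => a b /=; rewrite sqr_sqrtr// addr_ge0// sqr_ge0. Qed.

Lemma normc_ge0 z : 0 <= Normc.normc z.
Proof. by case: z => a b /=; rewrite sqrtr_ge0. Qed.

Lemma normc_gt0 z : (0 < Normc.normc z) = (z != 0).
Proof.
rewrite lt_def normc_ge0 andbT; apply/idP/idP; apply: contra.
  by move=> /eqP ->; rewrite Normc.normc0.
by move=> /eqP/Normc.eq0_normc ->.
Qed.

Lemma normRe_le z : `|complex.Re z| <= Normc.normc z.
Proof.
rewrite -(ler_pXn2r (ltn0Sn 1)) ?nnegrE ?normc_ge0//.
by rewrite normc_sqr real_normK ?num_real// lerDl sqr_ge0.
Qed.

Lemma normIm_le z : `|complex.Im z| <= Normc.normc z.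
Proof.
rewrite -(ler_pXn2r (ltn0Sn 1)) ?nnegrE ?normc_ge0//.
by rewrite normc_sqr real_normK ?num_real// lerDr sqr_ge0.
Qed.

Lemma Im_neq0 z : complex.Im z != 0 -> z != 0.
Proof. by apply: contra => /eqP ->. Qed.

Lemma upper_neq0 z : 0 < complex.Im z -> z != 0.
Proof. by move=> z0; rewrite Im_neq0// gt_eqF. Qed.

Lemma upper_subr z x : 0 < complex.Im z -> 0 < complex.Im (z - (x%:C)%C).
Proof. by rewrite ImD ImN /= subr0. Qed.

Lemma sub_real_neq0 z x : 0 < complex.Im z -> z - (x%:C)%C != 0.
Proof. by move=> z0; exact/upper_neq0/upper_subr. Qed.

Lemma ImV z : complex.Im z^-1 = - complex.Im z / Normc.normc z ^+ 2.
Proof. by rewrite normc_sqr; case: z => a b /=; rewrite mulNr. Qed.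

Lemma cexpD z w : cexp (z + w) = cexp z * cexp w.
Proof.
apply: complexP; rewrite ?(ReM, ImM) /= ReD ImD expRD.
  by rewrite cosD; ring.
by rewrite sinD; ring.
Qed.

Lemma cexp0 : cexp 0 = 1 :> R[i].
Proof. by apply: complexP => /=; rewrite expR0 ?cos0 ?sin0 mul1r. Qed.

Lemma normc_cexp z : Normc.normc (cexp z) = expR (complex.Re z).
Proof.
rewrite /= !exprMn -mulrDr cos2Dsin2 mulr1 sqrtr_sqr.
by rewrite ger0_norm ?expR_ge0.
Qed.

Lemma cexp_neq0 z : cexp z != 0.
Proof. by rewrite -normc_gt0 normc_cexp expR_gt0. Qed.

Lemma cexpN z : cexp (- z) = (cexp z)^-1.
Proof.
by apply: (mulfI (cexp_neq0 z)); rewrite mulfV ?cexp_neq0// -cexpD subrr cexp0.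
Qed.

Lemma cexpB z w : cexp (z - w) = cexp z / cexp w.
Proof. by rewrite cexpD cexpN. Qed.

Lemma cexp_real x : cexp (x%:C)%C = ((expR x)%:C)%C.
Proof. by apply: complexP; rewrite /= ?cos0 ?sin0 ?mulr1 ?mulr0. Qed.

Lemma Re_div_normc z : z != 0 -> -1 <= complex.Re z / Normc.normc z <= 1.
Proof.
rewrite -normc_gt0 => n0; rewrite -ler_norml normrM normfV.
by rewrite (gtr0_norm n0) ler_pdivrMr// mul1r normRe_le.
Qed.

Lemma cos_carg z : z != 0 -> cos (carg z) = complex.Re z / Normc.normc z.
Proof.
move=> z0; rewrite /carg /=; case: ifP => _; rewrite ?cosN acosK//.
all: by rewrite in_itv/= Re_div_normc.
Qed.

Lemma sin_carg z : z != 0 -> sin (carg z) = complex.Im z / Normc.normc z.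
Proof.
move=> z0; have n0 : 0 < Normc.normc z by rewrite normc_gt0.
have s : Num.sqrt (1 - (complex.Re z / Normc.normc z) ^+ 2) =
    `|complex.Im z| / Normc.normc z.
  rewrite -[in RHS](gtr0_norm n0) -normfV -normrM -sqrtr_sqr; congr Num.sqrt.
  apply: (mulIf (expf_neq0 2 (lt0r_neq0 n0))).
  rewrite mulrBl mul1r -!exprMn !divfK ?lt0r_neq0//.
  by rewrite normc_sqr addrC addKr.
rewrite /carg /=; case: ifPn => Iz; rewrite ?sinN sin_acos ?Re_div_normc// s.
  by rewrite ltr0_norm// mulNr opprK.
by rewrite ger0_norm// leNgt.
Qed.

(** A negative imaginary part forces |Re z| < |z|, so carg avoids -pi. *)
Lemma carg_bounds z : z != 0 -> - pi < carg z <= pi.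
Proof.
move=> z0; have n0 : 0 < Normc.normc z by rewrite normc_gt0.
have /andP[b1 b2] := Re_div_normc z0.
have pi0 : 0 < pi :> R := pi_gt0 R.
rewrite /carg /=; case: ifPn => Iz; last first.
  have := @acos_ge0 R (complex.Re z / Normc.normc z).
  have := @acos_lepi R (complex.Re z / Normc.normc z).
  rewrite b1 b2 => /(_ isT) -> /(_ isT) a0; rewrite andbT.
  by rewrite (lt_le_trans _ a0)// oppr_lt0.
have a0 := @acos_ge0 R (complex.Re z / Normc.normc z).
rewrite ltrN2 acos_ltpi/= ?(le_trans (lerN10 _))//; last first.
  rewrite b2 andbT lt_def b1 andbT; apply/eqP => e.
  have : complex.Im z ^+ 2 = 0.
    apply: (@addrI _ (complex.Re z ^+ 2)); rewrite -normc_sqr addr0.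
    rewrite -[complex.Re z](divfK (lt0r_neq0 n0)) e.
    by rewrite exprMn sqrrN expr1n mul1r.
  by move/eqP; rewrite sqrf_eq0 lt_eqF.
by rewrite (le_trans (y := 0))// ?oppr_le0 ?a0 ?b1// ltW.
Qed.

Lemma clogK z : z != 0 -> cexp (clog z) = z.
Proof.
move=> z0; have n0 : 0 < Normc.normc z by rewrite normc_gt0.
apply: complexP; rewrite /= lnK ?posrE// ?cos_carg ?sin_carg// mulrC divfK//.
all: by rewrite lt0r_neq0.
Qed.

Lemma cexpK w : - pi < complex.Im w <= pi -> clog (cexp w) = w.
Proof.
move=> /andP[w1 w2]; have e0 := expR_gt0 (complex.Re w).
apply: complexP; rewrite /= -?/(Normc.normc (cexp w)).
  by rewrite [Num.sqrt _](normc_cexp w) expRK.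
rewrite /carg normc_cexp /= mulrAC divff ?lt0r_neq0// mul1r pmulr_rlt0//.
have [i0|i0] := lerP 0 (complex.Im w).
  rewrite ifF; last by apply/negbTE; rewrite -leNgt sin_ge0_pi// i0.
  by rewrite cosK// in_itv/= i0.
rewrite ifT; last by rewrite -oppr_gt0 -sinN sin_gt0_pi// oppr_gt0 i0 ltrNl.
by rewrite cosKN ?opprK// (ltW i0) ltW.
Qed.

Lemma carg_upper z : 0 < complex.Im z -> 0 < carg z < pi.
Proof.
move=> z0; have zn0 := upper_neq0 z0.
have n0 : 0 < Normc.normc z by rewrite normc_gt0.
have s0 : 0 < sin (carg z) by rewrite sin_carg// divr_gt0.
have /andP[c1 c2] := carg_bounds zn0; apply/andP; split.
  rewrite ltNge; apply/negP => c0; have : 0 <= sin (- carg z).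
    by rewrite sin_ge0_pi// oppr_ge0 c0/= lerNl ltW.
  by rewrite sinN oppr_ge0 leNgt s0.
by rewrite lt_def c2 andbT; apply: contraTneq s0 => <-; rewrite sinpi ltxx.
Qed.

(** The difference of two arguments in ]0, pi[ lies in ]-pi, pi[, so no branch
    correction occurs. *)
Lemma clog_div z w : 0 < complex.Im z -> 0 < complex.Im w ->
  clog (z / w) = clog z - clog w.
Proof.
move=> z0 w0; rewrite -[in LHS](clogK (upper_neq0 z0)).
rewrite -[in LHS](clogK (upper_neq0 w0)) -cexpB cexpK// ImD ImN /=.
by move: (carg_upper z0) (carg_upper w0) => /andP[? ?] /andP[? ?]; lra.
Qed.

Lemma cpowE z l : z != 0 -> cpow z l = cexp ((l%:C)%C * clog z).
Proof. by rewrite /cpow => /negbTE ->. Qed.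

Lemma cpow_neq0 z l : z != 0 -> cpow z l != 0.
Proof. by move=> z0; rewrite cpowE// cexp_neq0. Qed.

Lemma cpow1 z : z != 0 -> cpow z 1 = z.
Proof. by move=> z0; rewrite cpowE// rmorph1 mul1r clogK. Qed.

Lemma cpowN z l : z != 0 -> cpow z (- l) = (cpow z l)^-1.
Proof. by move=> z0; rewrite !cpowE// rmorphN mulNr cexpN. Qed.

Lemma cpowD z (k l : R) : z != 0 -> cpow z (k + l) = cpow z k * cpow z l.
Proof. by move=> z0; rewrite !cpowE// rmorphD mulrDl cexpD. Qed.

Lemma cpow_div z w l : 0 < complex.Im z -> 0 < complex.Im w ->
  cpow (z / w) l = cpow z l / cpow w l.
Proof.
move=> z0 w0; have zn := upper_neq0 z0; have wn := upper_neq0 w0.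
by rewrite !cpowE ?mulf_neq0 ?invr_eq0// clog_div// mulrBr cexpB.
Qed.

Lemma normc_cpow z l : z != 0 -> Normc.normc (cpow z l) = Normc.normc z `^ l.
Proof.
move=> z0; rewrite cpowE// normc_cexp ReMc /powR gt_eqF//.
by rewrite normc_gt0.
Qed.

End ComplexElementary.

(** * Derivatives of complex functions of a real variable *)

Section ComplexCalculus.
Context {R : realType}.
Implicit Types (f g : R -> R[i]) (x : R) (z : R[i]).

Definition is_cderive f x (df : R[i]) :=
  is_derive x 1 (fun t => complex.Re (f t)) (complex.Re df) /\
  is_derive x 1 (fun t => complex.Im (f t)) (complex.Im df).

Lemma is_cderive_eq f x (df dg : R[i]) :
  is_cderive f x df -> df = dg -> is_cderive f x dg.
Proof. by move=> ? <-. Qed.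

Lemma is_cderive_cst z x : is_cderive (fun=> z) x 0.
Proof. by split; apply: is_derive_cst. Qed.

Lemma is_cderive_real (h : R -> R) x (dh : R) :
  is_derive x 1 h dh -> is_cderive (fun t => ((h t)%:C)%C) x (dh%:C)%C.
Proof. by move=> hx; split => //=; apply: is_derive_cst. Qed.

Lemma is_cderiveD f g x (df dg : R[i]) : is_cderive f x df ->
  is_cderive g x dg -> is_cderive (fun t => f t + g t) x (df + dg).
Proof.
move=> [f1 f2] [g1 g2]; split.
  rewrite (_ : (fun t => _) = (fun t => complex.Re (f t)) +
      (fun t => complex.Re (g t))); last by apply/funext => t; rewrite ReD.
  by rewrite ReD; apply: is_deriveD.
rewrite (_ : (fun t => _) = (fun t => complex.Im (f t)) +
    (fun t => complex.Im (g t))); last by apply/funext => t; rewrite ImD.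
by rewrite ImD; apply: is_deriveD.
Qed.

Lemma is_cderiveM f g x (df dg : R[i]) : is_cderive f x df ->
  is_cderive g x dg -> is_cderive (fun t => f t * g t) x (df * g x + f x * dg).
Proof.
move=> [f1 f2] [g1 g2]; split.
  rewrite (_ : (fun t => _) =
      (fun t => complex.Re (f t)) * (fun t => complex.Re (g t)) -
      (fun t => complex.Im (f t)) * (fun t => complex.Im (g t))); last first.
    by apply/funext => t; rewrite ReM.
  apply: is_derive_eq; rewrite ReD !ReM /GRing.scale /=; ring.
rewrite (_ : (fun t => _) =
    (fun t => complex.Re (f t)) * (fun t => complex.Im (g t)) +
    (fun t => complex.Im (f t)) * (fun t => complex.Re (g t))); last first.
  by apply/funext => t; rewrite ImM.
apply: is_derive_eq (is_deriveD (is_deriveM f1 g2) (is_deriveM f2 g1)) _.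
by rewrite ImD !ImM /GRing.scale /=; ring.
Qed.

Lemma is_cderiveZ z f x (df : R[i]) : is_cderive f x df ->
  is_cderive (fun t => z * f t) x (z * df).
Proof.
move=> fx; apply: is_cderive_eq (is_cderiveM (is_cderive_cst z x) fx) _.
by rewrite mul0r add0r.
Qed.

Lemma is_cderiveN f x (df : R[i]) : is_cderive f x df ->
  is_cderive (fun t => - f t) x (- df).
Proof.
move=> /(is_cderiveZ (-1)); rewrite mulN1r.
by under [fun t => _ * _]funext do rewrite mulN1r.
Qed.

Lemma is_cderiveB f g x (df dg : R[i]) : is_cderive f x df ->
  is_cderive g x dg -> is_cderive (fun t => f t - g t) x (df - dg).
Proof. by move=> fx /is_cderiveN; exact: is_cderiveD. Qed.

Lemma is_cderive_exp f x (df : R[i]) : is_cderive f x df ->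
  is_cderive (fun t => cexp (f t)) x (df * cexp (f x)).
Proof.
move=> [f1 f2].
have e : is_derive x 1 (fun t => expR (complex.Re (f t)))
    (expR (complex.Re (f x)) * complex.Re df).
  by apply: (@is_derive1_comp R expR) => //; exact: is_derive_expR.
have c : is_derive x 1 (fun t => cos (complex.Im (f t)))
    (- sin (complex.Im (f x)) * complex.Im df).
  by apply: (@is_derive1_comp R cos) => //; exact: is_derive_cos.
have s : is_derive x 1 (fun t => sin (complex.Im (f t)))
    (cos (complex.Im (f x)) * complex.Im df).
  by apply: (@is_derive1_comp R sin) => //; exact: is_derive_sin.
split.
  rewrite (_ : (fun t => _) = (fun t => expR (complex.Re (f t))) *
     (fun t => cos (complex.Im (f t))))//.
  apply: is_derive_eq; rewrite ReM /GRing.scale /=; ring.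
rewrite (_ : (fun t => _) = (fun t => expR (complex.Re (f t))) *
   (fun t => sin (complex.Im (f t))))//.
apply: is_derive_eq; rewrite ImM /GRing.scale /=; ring.
Qed.

Lemma is_cderiveV f x (df : R[i]) : f x != 0 -> is_cderive f x df ->
  is_cderive (fun t => (f t)^-1) x (- df / f x ^+ 2).
Proof.
move=> fx0 [f1 f2].
set u := fun t => complex.Re (f t); set v := fun t => complex.Im (f t).
have n0 : u x ^+ 2 + v x ^+ 2 != 0.
  by rewrite -normc_sqr expf_neq0// gt_eqF// normc_gt0.
have dn : is_derive x 1 (fun t => u t ^+ 2 + v t ^+ 2)
    (2 * (u x * complex.Re df + v x * complex.Im df)).
  have -> : (fun t => u t ^+ 2 + v t ^+ 2) = u * u + v * v by [].
  apply: is_derive_eq (is_deriveD (is_deriveM f1 f1) (is_deriveM f2 f2)) _.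
  by rewrite /GRing.scale /= -/u -/v; ring.
have dV := @is_deriveV R (fun t => u t ^+ 2 + v t ^+ 2) x _ _ n0 dn.
have eVe : forall z : R[i], z^-1 =
    (complex.Re z / (complex.Re z ^+ 2 + complex.Im z ^+ 2) +i*
     (- complex.Im z / (complex.Re z ^+ 2 + complex.Im z ^+ 2)))%C.
  by case=> a b /=; rewrite mulNr.
have E : - df / f x ^+ 2 = - df * ((f x)^-1) ^+ 2 by rewrite exprVn.
split.
  rewrite (_ : (fun t => _) =
      u * (fun t => (u t ^+ 2 + v t ^+ 2)^-1)); last first.
    by apply/funext => t; rewrite eVe.
  apply: is_derive_eq; rewrite E expr2 !(ReM, ImM, ReN, ImN) eVe.
  rewrite /GRing.scale /= -/(u x) -/(v x); field.
  exact: n0.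
rewrite (_ : (fun t => _) =
    (- v) * (fun t => (u t ^+ 2 + v t ^+ 2)^-1)); last first.
  by apply/funext => t; rewrite eVe.
apply: is_derive_eq; rewrite E expr2 !(ReM, ImM, ReN, ImN) eVe.
rewrite /GRing.scale /= -/(u x) -/(v x) fctE; field.
exact: n0.
Qed.

Lemma is_cderive_log z x : 0 < complex.Im z ->
  is_cderive (fun t => clog (z - (t%:C)%C)) x (- (z - (x%:C)%C)^-1).
Proof.
case: z => a b /= b0.
pose N t : R := (a - t) ^+ 2 + b ^+ 2.
have N0 t : 0 < N t by rewrite ltr_wpDl ?sqr_ge0// exprn_gt0.
have dN : is_derive x 1 N (- 2 * (a - x)).
  rewrite (_ : N = (cst a - id) * (cst a - id) + cst (b ^+ 2))//.
  by apply: is_derive_eq; rewrite /GRing.scale /= !fctE; ring.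
have nE t : Normc.normc ((a +i* b)%C - (t%:C)%C) = Num.sqrt (N t).
  by rewrite /= subr0.
have dS : is_derive x 1 (fun t => Num.sqrt (N t))
    ((2 * Num.sqrt (N x))^-1 * (- 2 * (a - x))).
  by apply: (@is_derive1_comp R Num.sqrt) => //; exact: is_derive1_sqrt.
have S0 t : 0 < Num.sqrt (N t) by rewrite sqrtr_gt0.
have S2 t : Num.sqrt (N t) ^+ 2 = N t by rewrite sqr_sqrtr// ltW.
split.
  rewrite (_ : (fun t => _) = (fun t => ln (Num.sqrt (N t)))); last first.
    by apply/funext => t; rewrite /clog /= -nE.
  have dL : is_derive x 1 (fun t => ln (Num.sqrt (N t)))
      ((Num.sqrt (N x))^-1 * ((2 * Num.sqrt (N x))^-1 * (- 2 * (a - x)))).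
    apply: (@is_derive1_comp R (@ln R) (fun t => Num.sqrt (N t))) dS.
    exact: is_derive1_ln (S0 x).
  apply: is_derive_eq dL _.
  rewrite /= subr0; have -> : (a - x) ^+ 2 + b ^+ 2 = Num.sqrt (N x) ^+ 2 by rewrite S2.
  field.
  by rewrite gt_eqF.
rewrite (_ : (fun t => _) = (fun t => acos ((a - t) / Num.sqrt (N t)))); last first.
  apply/funext => t; rewrite /clog /carg nE /= subr0 ifF//.
  by apply/negbTE; rewrite -leNgt ltW.
pose q t := (a - t) / Num.sqrt (N t).
have q2 : 1 - q x ^+ 2 = (b / Num.sqrt (N x)) ^+ 2.
  rewrite /q !expr_div_n S2 /N; field.
  exact: lt0r_neq0 (N0 x).
have sq : Num.sqrt (1 - q x ^+ 2) = b / Num.sqrt (N x).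
  by rewrite q2 sqrtr_sqr ger0_norm// ltW// divr_gt0.
have q1 : -1 < q x < 1.
  rewrite -ltr_norml -(@ltr_pXn2r _ 2)// ?nnegrE// expr1n real_normK ?num_real//.
  by rewrite -subr_gt0 q2 exprn_gt0// divr_gt0.
have dq : is_derive x 1 q (- b ^+ 2 / Num.sqrt (N x) ^+ 3).
  rewrite (_ : q = (cst a - id) * (fun t => (Num.sqrt (N t))^-1))//.
  have dV := @is_deriveV R (fun t => Num.sqrt (N t)) x _ _
    (lt0r_neq0 (S0 x)) dS.
  apply: is_derive_eq; rewrite /GRing.scale /= !fctE.
  have -> : b ^+ 2 = Num.sqrt (N x) ^+ 2 - (a - x) ^+ 2 by rewrite S2 /N; ring.
  by field; rewrite gt_eqF.
have dA : is_derive x 1 (fun t => acos (q t))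
    (- (Num.sqrt (1 - q x ^+ 2))^-1 * (- b ^+ 2 / Num.sqrt (N x) ^+ 3)).
  by apply: (@is_derive1_comp R (@acos R) q) dq; exact: is_derive1_acos q1.
apply: is_derive_eq dA _.
rewrite sq /= subr0.
have -> : (a - x) ^+ 2 + b ^+ 2 = Num.sqrt (N x) ^+ 2 by rewrite S2.
field.
by rewrite !gt_eqF.
Qed.

Lemma is_cderive_cpow z (l : R) x : 0 < complex.Im z ->
  is_cderive (fun t => cpow (z - (t%:C)%C) l) x
    ((l%:C)%C * - (z - (x%:C)%C)^-1 * cpow (z - (x%:C)%C) l).
Proof.
move=> z0.
rewrite (_ : (fun t => _) = fun t => cexp ((l%:C)%C * clog (z - (t%:C)%C))).
  apply: is_cderive_eq.
    exact/is_cderive_exp/is_cderiveZ/is_cderive_log.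
  by rewrite cpowE// sub_real_neq0.
by apply/funext => t; rewrite cpowE// sub_real_neq0.
Qed.

Lemma is_cderive_comp f (h : R -> R) x (df : R[i]) (dh : R) :
  is_cderive f (h x) df -> is_derive x 1 h dh ->
  is_cderive (fun t => f (h t)) x ((dh%:C)%C * df).
Proof.
move=> [f1 f2] hx; split; rewrite ?ReMc ?ImMc mulrC.
  by apply: (@is_derive1_comp R (fun t => complex.Re (f t)) h).
by apply: (@is_derive1_comp R (fun t => complex.Im (f t)) h).
Qed.

End ComplexCalculus.

(** * Integration of complex functions *)

Section ComplexIntegral.
Context {R : realType}.

(** On the real line this is convertible to cintegral. *)
Definition cint d (T : measurableType d) (mu : {measure set T -> \bar R})
    (f : T -> R[i]) : R[i] :=
  (Rintegral mu setT (fun x => complex.Re (f x)) +i*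
   Rintegral mu setT (fun x => complex.Im (f x)))%C.

Definition cmeasurable d (T : measurableType d) (f : T -> R[i]) :=
  measurable_fun setT (fun x => complex.Re (f x)) /\
  measurable_fun setT (fun x => complex.Im (f x)).

Definition bounded_cmeasurable d (T : measurableType d) (f : T -> R[i]) :=
  cmeasurable f /\ exists M : R, forall x, Normc.normc (f x) <= M.

Section OneSpace.
Context d (T : measurableType d).
Implicit Types (f g : T -> R[i]) (P : probability T R).

Lemma cmeasurable_cst (z : R[i]) : cmeasurable (fun _ : T => z).
Proof. by split; exact: measurable_cst. Qed.

Lemma cmeasurable_real (h : T -> R) : measurable_fun setT h ->
  cmeasurable (fun x => ((h x)%:C)%C).
Proof. by move=> mh; split => //=; exact: measurable_cst. Qed.

Lemma cmeasurableM f g : cmeasurable f -> cmeasurable g ->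
  cmeasurable (fun x => f x * g x).
Proof.
move=> [f1 f2] [g1 g2]; split.
  under eq_fun do rewrite ReM.
  by apply: measurable_funB; exact: measurable_funM.
under eq_fun do rewrite ImM.
by apply: measurable_funD; exact: measurable_funM.
Qed.

Lemma bounded_cmeasurable_cst (z : R[i]) : bounded_cmeasurable (fun _ : T => z).
Proof. by split; [exact: cmeasurable_cst|exists (Normc.normc z)]. Qed.

Lemma bounded_cmeasurableM f g : bounded_cmeasurable f ->
  bounded_cmeasurable g -> bounded_cmeasurable (fun x => f x * g x).
Proof.
move=> [mf [M fM]] [mg [N gN]]; split; first exact: cmeasurableM.
by exists (M * N) => x; rewrite Normc.normcM ler_pM ?normc_ge0.
Qed.

Lemma bounded_integrable P (h : T -> R) (M : R) : measurable_fun setT h ->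
  (forall x, `|h x| <= M) -> P.-integrable setT (EFin \o h).
Proof.
move=> mh hM; apply: measurable_bounded_integrable => //.
  exact: fin_num_fun_lty (fin_num_measure P).
exists M; split; first exact: num_real.
by move=> r Mr x _ /=; apply: (le_trans (hM x)); exact: ltW.
Qed.

Lemma bounded_cmeasurable_Re P f : bounded_cmeasurable f ->
  P.-integrable setT (EFin \o (fun x => complex.Re (f x))).
Proof.
move=> [[mf _] [M fM]]; apply: (@bounded_integrable P _ M) => // x.
exact: le_trans (normRe_le _) (fM x).
Qed.

Lemma bounded_cmeasurable_Im P f : bounded_cmeasurable f ->
  P.-integrable setT (EFin \o (fun x => complex.Im (f x))).
Proof.
move=> [[_ mf] [M fM]]; apply: (@bounded_integrable P _ M) => // x.
exact: le_trans (normIm_le _) (fM x).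
Qed.

Lemma Rintegral_prob_cst P (r : R) : Rintegral P setT (fun=> r) = r.
Proof.
have := @Rintegral_cst _ T R P setT measurableT r.
by rewrite [X in fine X](probability_setT P) mulr1.
Qed.

Lemma cint_cst P (z : R[i]) : cint P (fun=> z) = z.
Proof. by apply: complexP; rewrite /= Rintegral_prob_cst. Qed.

Lemma cintD P f g : bounded_cmeasurable f -> bounded_cmeasurable g ->
  cint P (fun x => f x + g x) = cint P f + cint P g.
Proof.
move=> bf bg; apply: complexP => /=; rewrite -RintegralD//.
all: try exact: bounded_cmeasurable_Re; try exact: bounded_cmeasurable_Im.
  by apply: eq_Rintegral => x _; rewrite ReD.
by apply: eq_Rintegral => x _; rewrite ImD.
Qed.

Lemma cintZ P (z : R[i]) f : bounded_cmeasurable f ->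
  cint P (fun x => z * f x) = z * cint P f.
Proof.
move=> bf.
have iR := bounded_cmeasurable_Re P bf; have iI := bounded_cmeasurable_Im P bf.
have iZ (r : R) (h : T -> R) : P.-integrable setT (EFin \o h) ->
    P.-integrable setT (EFin \o (fun x => r * h x)).
  by move=> ih; exact: (integrableZl measurableT r ih).
apply: complexP; rewrite ?ReM ?ImM /= -!RintegralZl//.
  rewrite -RintegralB//; [|exact: iZ..].
  by apply: eq_Rintegral => x _; rewrite ReM.
rewrite -RintegralD//; [|exact: iZ..].
by apply: eq_Rintegral => x _; rewrite ImM.
Qed.

(** With I the integral of f, |I|^2 is the integral of Re (conj I * f), which
    is at most |I| times the integral of |f|. *)
Lemma normc_cint_le P f (h : T -> R) (M : R) : cmeasurable f ->
  measurable_fun setT h -> (forall x, h x <= M) ->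
  (forall x, Normc.normc (f x) <= h x) ->
  Normc.normc (cint P f) <= Rintegral P setT h.
Proof.
move=> mf mh hM fh; set I := cint P f.
have bf : bounded_cmeasurable f.
  by split => //; exists M => x; exact: le_trans (fh x) (hM x).
have h0 x : 0 <= h x by exact: le_trans (normc_ge0 _) (fh x).
have ih : P.-integrable setT (EFin \o h).
  by apply: (@bounded_integrable P _ M) => // x; rewrite ger0_norm.
have [I0|I0] := eqVneq (Normc.normc I) 0.
  by rewrite I0 Rintegral_ge0.
have {}I0 : 0 < Normc.normc I by rewrite lt_def I0 normc_ge0.
have bIf := bounded_cmeasurableM (bounded_cmeasurable_cst (conjc I)) bf.
rewrite -(ler_pM2l I0) -expr2 -RintegralZl//.
have -> : Normc.normc I ^+ 2 = complex.Re (cint P (fun x => conjc I * f x)).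
  by rewrite cintZ// -/I normc_sqr; case: (I) => a b /=; ring.
apply: le_Rintegral => //.
- exact: bounded_cmeasurable_Re bIf.
- exact: (integrableZl measurableT (Normc.normc I) ih).
- move=> x _; apply: le_trans (ler_norm _) _; apply: le_trans (normRe_le _) _.
  rewrite Normc.normcM ler_pM ?normc_ge0//.
  by case: (I) => a b /=; rewrite sqrrN.
Qed.

End OneSpace.

Lemma bounded_cmeasurable_comp d (T : measurableType d) d' (S : measurableType d')
  (f : S -> R[i]) (X : T -> S) : measurable_fun setT X ->
  bounded_cmeasurable f -> bounded_cmeasurable (fun x => f (X x)).
Proof.
move=> mX [[f1 f2] [M fM]]; split; last by exists M.
by split; [exact: (measurableT_comp f1)|exact: (measurableT_comp f2)].
Qed.

Lemma cint_Fubini d1 (T1 : measurableType d1) d2 (T2 : measurableType d2)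
  (P1 : probability T1 R) (P2 : probability T2 R) (f : T1 * T2 -> R[i]) :
  bounded_cmeasurable f ->
  cint (P1 \x P2)%E f = cint P1 (fun x => cint P2 (fun y => f (x, y))).
Proof.
move=> bf.
have sect x : bounded_cmeasurable (fun y => f (x, y)).
  exact: (bounded_cmeasurable_comp (pair1_measurable x)).
have E (h : T1 * T2 -> R) : (P1 \x P2)%E.-integrable setT (EFin \o h) ->
    (forall x, P2.-integrable setT (EFin \o (fun y => h (x, y)))) ->
    Rintegral (P1 \x P2)%E setT h =
    Rintegral P1 setT (fun x => Rintegral P2 setT (fun y => h (x, y))).
  move=> ih ihx; rewrite /Rintegral.
  rewrite -(integral12_prod_meas1 ih); congr fine.
  apply: eq_integral => x _; rewrite fineK//.
  exact: integrable_fin_num (ihx x).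
apply: complexP; rewrite /= E//.
- exact: bounded_cmeasurable_Re.
- by move=> x; apply: bounded_cmeasurable_Re.
- exact: bounded_cmeasurable_Im.
- by move=> x; apply: bounded_cmeasurable_Im.
Qed.

Lemma law_exists d (T : measurableType d) (P : probability T R)
    (X : T -> measurableTypeR R) : measurable_fun setT X ->
  exists mu : probability (measurableTypeR R) R,
    forall f : measurableTypeR R -> R[i], bounded_cmeasurable f ->
      cint mu f = cint P (fun x => f (X x)).
Proof.
move=> mX; pose X' : {mfun T >-> measurableTypeR R} := mfun_Sub (mem_set mX).
exists (distribution P X') => f bf.
have bfX := bounded_cmeasurable_comp mX bf.
have [[f1 f2] _] := bf.
apply: complexP; rewrite /= /Rintegral integral_distribution//.
- exact/measurable_EFinP.
- exact: bounded_cmeasurable_Re bfX.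
- exact/measurable_EFinP.
- exact: bounded_cmeasurable_Im bfX.
Qed.

End ComplexIntegral.

(** * The Stieltjes kernel and the lower bound on the exponent *)

Section StieltjesKernel.
Context {R : realType}.
Implicit Types (z : R[i]) (l x : R).

Lemma is_cderive_continuous (f : R -> R[i]) :
  (forall x, exists df, is_cderive f x df) ->
  continuous (fun x => complex.Re (f x)) /\
  continuous (fun x => complex.Im (f x)).
Proof.
by move=> fd; split=> x; have [df [[d1 _] [d2 _]]] := fd x;
  apply/differentiable_continuous/derivable1_diffP.
Qed.

Lemma is_cderive_cmeasurable (f : R -> R[i]) :
  (forall x, exists df, is_cderive f x df) ->
  cmeasurable (f : measurableTypeR R -> R[i]).
Proof.
move=> /is_cderive_continuous[c1 c2].
by split; exact: continuous_measurable_fun.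
Qed.

Lemma normc_kernel_le z l x : 0 < complex.Im z -> 0 <= l ->
  Normc.normc (cpow (z - (x%:C)%C) (- l)) <= complex.Im z `^ (- l).
Proof.
move=> z0 l0; rewrite normc_cpow ?sub_real_neq0// !powRN.
have n0 : 0 < Normc.normc (z - (x%:C)%C) by rewrite normc_gt0 sub_real_neq0.
rewrite lef_pV2 ?posrE ?powR_gt0//.
rewrite ge0_ler_powR ?nnegrE ?(ltW z0) ?(ltW n0)//.
have := normIm_le (z - (x%:C)%C); rewrite ImD ImN /= oppr0 addr0.
by rewrite ger0_norm ?(ltW z0).
Qed.

Lemma bounded_kernel z l : 0 < complex.Im z -> 0 <= l ->
  bounded_cmeasurable
    (fun x : measurableTypeR R => cpow (z - (x%:C)%C) (- l)).
Proof.
move=> z0 l0; split.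
  apply: is_cderive_cmeasurable => x; eexists; exact: is_cderive_cpow.
by exists (complex.Im z `^ (- l)) => x; exact: normc_kernel_le.
Qed.

Lemma gen_stieltjesE l (mu : {measure set (measurableTypeR R) -> \bar R}) z :
  0 < complex.Im z -> gen_stieltjes l mu z =
  cint mu (fun x : measurableTypeR R => cpow (z - (x%:C)%C) (- l)).
Proof.
move=> z0; rewrite /gen_stieltjes; congr (cintegral mu _); apply/funext => x.
by rewrite cpowN ?sub_real_neq0// div1r.
Qed.

Lemma stieltjesE (mu : {measure set (measurableTypeR R) -> \bar R}) z :
  0 < complex.Im z -> stieltjes mu z =
  cint mu (fun x : measurableTypeR R => cpow (z - (x%:C)%C) (- 1)).
Proof.
move=> z0; rewrite /stieltjes; congr (cintegral mu _); apply/funext => x.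
by rewrite cpowN ?sub_real_neq0// cpow1 ?sub_real_neq0// div1r.
Qed.

End StieltjesKernel.

Section Necessity.
Context {R : realType}.

Lemma normc_transform_lower (e a : R) : 0 < e -> a ^+ 2 = 1 ->
  (2 * e)^-1 <= Normc.normc ((a +i* e)%C / ((a +i* e)%C ^+ 2 - 1)).
Proof.
move=> e0 a2; set z := (a +i* e)%C.
have n0 : 0 < Normc.normc z by rewrite normc_gt0 upper_neq0.
have nz2 : Normc.normc z ^+ 2 = 1 + e ^+ 2 by rewrite normc_sqr a2.
have nE : Normc.normc (z ^+ 2 - 1) ^+ 2 = e ^+ 2 * (4 + e ^+ 2).
  rewrite normc_sqr expr2 ReD ImD ReN ImN ReM ImM /=.
  have -> : a * a = 1 by rewrite -expr2.
  rewrite oppr0 addr0.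
  have -> : (1 - e * e - 1) ^+ 2 + (a * e + e * a) ^+ 2 =
    e ^+ 2 * (4 * a ^+ 2 + e ^+ 2) by ring.
  by rewrite a2 mulr1.
have d0 : 0 < Normc.normc (z ^+ 2 - 1).
  rewrite lt_def normc_ge0 andbT -sqrf_eq0 nE mulf_neq0// ?expf_neq0 ?gt_eqF//.
  by rewrite ltr_wpDr// sqr_ge0.
rewrite Normc.normcM Normc.normcV ler_pdivlMr// mulrC ler_pdivrMr ?mulr_gt0//.
rewrite -(@ler_pXn2r _ 2)// ?nnegrE ?mulr_ge0 ?normc_ge0 ?(ltW e0)//.
rewrite exprMn nz2 nE exprMn.
have : 0 <= e ^+ 2 by exact: sqr_ge0.
move: (e ^+ 2) => E E0; nra.
Qed.

(** Evaluated at 1 + ie and -1 + ie, the identity forces an atom of mass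
    at least 2^-l at both points; as e tends to 0 the two atoms give
    2 * 2^-l <= 1. *)
Lemma transform_exponent_ge1 (l : R) (mu : probability (measurableTypeR R) R) :
  0 < l -> (forall z : R[i], 0 < complex.Im z ->
    gen_stieltjes l mu z = cpow (z / (z ^+ 2 - 1)) l) -> 1 <= l.
Proof.
move=> l0 H.
have far1 (x : R) : 0 <= x -> 1 <= `|-1 - x|.
  by move=> x0; rewrite ler0_norm; lra.
have far2 (x : R) : x < 0 -> 1 <= `|1 - x|.
  by move=> x0; rewrite ger0_norm; lra.
pose h (a e x : R) := Normc.normc ((a +i* e)%C - (x%:C)%C) `^ (- l).
have hle (a e x : R) : 0 < e -> h a e x <= e `^ (- l).
  move=> e0; rewrite /h -normc_cpow ?sub_real_neq0//.
  by apply: (@normc_kernel_le R (a +i* e)%C); rewrite ?ltW.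
have h1 (a e x : R) : 0 < e -> 1 <= `|a - x| -> h a e x <= 1.
  move=> e0 ax; rewrite /h powRN invf_le1; last first.
    by rewrite powR_gt0// normc_gt0 sub_real_neq0.
  rewrite -[leLHS](powRr0 (Normc.normc ((a +i* e)%C - (x%:C)%C))).
  apply: ler_powR; last exact: ltW.
  apply: le_trans ax _.
  by have := normRe_le ((a +i* e)%C - (x%:C)%C); rewrite ReD ReN.
have h0 a e x : 0 <= h a e x by exact: powR_ge0.
have mh (a e : R) : 0 < e -> measurable_fun setT (h a e : measurableTypeR R -> R).
  move=> e0; rewrite /h.
  have md : measurable_fun setT
     (fun x : measurableTypeR R => (a - x) ^+ 2 + e ^+ 2).
    apply: measurable_funD => //; apply: measurable_funX.
    exact: measurable_funB.
  have ms : measurable_fun setT (@Num.sqrt R : measurableTypeR R -> R).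
    by apply: continuous_measurable_fun => x; exact: sqrt_continuous.
  have := measurableT_comp (@measurable_powR R (- l)) (measurableT_comp ms md).
  by congr measurable_fun; apply/funext => x /=; rewrite subr0.
(* Since x is at distance at least 1 from 1 or from -1, one of the two kernels
   is at most 1, and the other is at most e^(-l). *)
have key (e : R) : 0 < e -> 2 * (2 * e) `^ (- l) <= e `^ (- l) + 1.
  move=> e0.
  have N a : a ^+ 2 = 1 -> (2 * e) `^ (- l) <= Rintegral mu setT (h a e).
    move=> a2.
    have z0 : 0 < complex.Im (a +i* e)%C by [].
    have F0 : 0 < Normc.normc ((a +i* e)%C / ((a +i* e)%C ^+ 2 - 1)).
      by apply: lt_le_trans (normc_transform_lower e0 a2); rewrite invr_gt0 mulr_gt0.
    have := H _ z0; rewrite gen_stieltjesE// => HE.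
    apply: le_trans (@normc_cint_le _ _ _ mu
      (fun x : measurableTypeR R => cpow ((a +i* e)%C - (x%:C)%C) (- l))
      (h a e) (e `^ (- l)) _ (mh _ _ e0) (fun x => hle a e x e0) _).
    - rewrite HE normc_cpow -?normc_gt0//.
      have -> : (2 * e) `^ (- l) = (2 * e)^-1 `^ l.
        by rewrite -powR_inv1 ?mulr_ge0 ?(ltW e0)// -powRrM mulN1r.
      rewrite ge0_ler_powR ?nnegrE ?normc_ge0 ?invr_ge0 ?mulr_ge0 ?(ltW l0) ?(ltW e0)//.
      exact: normc_transform_lower.
    - exact: (bounded_kernel z0 (ltW l0)).1.
    - by move=> x; rewrite normc_cpow ?sub_real_neq0.
  have ih a : mu.-integrable setT (EFin \o (h a e)).
    apply: (@bounded_integrable _ _ _ _ _ (e `^ (- l))); first exact: mh.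
    by move=> x; rewrite ger0_norm ?hle.
  have N1 := N 1 (expr1n _ _); have N2 := N (-1) (etrans (sqrrN 1) (expr1n _ _)).
  have -> : 2 * (2 * e) `^ (- l) = (2 * e) `^ (- l) + (2 * e) `^ (- l) by ring.
  apply: le_trans (lerD N1 N2) _; rewrite -RintegralD//; [|exact: ih..].
  rewrite -[leRHS](Rintegral_prob_cst mu); apply: le_Rintegral => //.
  - exact: (integrableD measurableT (ih 1) (ih (-1))).
  - apply: (@bounded_integrable _ _ _ _ _ (`|e `^ (- l) + 1|)) => //.
  move=> x _; have [x0|x0] := lerP 0 x.
    apply: lerD; first exact: hle.
    by apply: h1 => //; exact: far1.
  rewrite addrC; apply: lerD; first exact: hle.
  by apply: h1 => //; exact: far2.
rewrite leNgt; apply/negP => l1.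
pose d : R := 2 * 2 `^ (- l) - 1.
have d0 : 0 < d.
  rewrite subr_gt0 -[X in X * _](powRr1 (ltW (ltr0n R 2))).
  rewrite -powRD; last by rewrite pnatr_eq0 implybT.
  rewrite /powR pnatr_eq0/= expR_gt1 mulr_gt0 ?subr_gt0//.
  by rewrite ln_gt0// ltr1n.
pose e := (d / 2) `^ l^-1.
have q0 : 0 < d / 2 by exact: divr_gt0.
have e0 : 0 < e by exact: powR_gt0.
have eE : e `^ l = d / 2.
  by rewrite /e -powRrM mulVf ?gt_eqF// powRr1// ltW.
have := key e e0; rewrite powRM ?(ltW e0)// [e `^ (- l)]powRN eE mulrA.
have -> : 2 * 2 `^ (- l) = d + 1 by rewrite /d subrK.
move: q0; move: (d) => c q0.
have {1}-> : c = c / 2 * 2 by rewrite divfK// pnatr_eq0.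
move: (c / 2) q0 => q q0; rewrite ler_pdivrMr// mulrDl mulVf ?gt_eqF//.
by lra.
Qed.

End Necessity.

(** * Probability measures given by a density *)

Section DensityProbability.
Context {R : realType}.
Local Notation leb := (@lebesgue_measure R).
Variables (g : measurableTypeR R -> R) (mg : measurable_fun setT g).
Hypotheses (g_ge0 : forall x, 0 <= g x) (g_int : (\int[leb]_x (g x)%:E = 1)%E).

(** The hypotheses are parameters so that the measure structures below can be
    found by unification. *)
Definition density_prob of measurable_fun setT g & (forall x, 0 <= g x) &
    (\int[leb]_x (g x)%:E = 1)%E : set (measurableTypeR R) -> \bar R :=
  fun V => (\int[leb]_(x in V) (g x)%:E)%E.

Local Notation P := (density_prob mg g_ge0 g_int).

Let P0 : P set0 = 0%E. Proof. by rewrite /density_prob integral_set0. Qed.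

Let P_ge0 A : (0 <= P A)%E.
Proof. by apply: integral_ge0 => x _; rewrite lee_fin. Qed.

Let P_sigma_additive : semi_sigma_additive P.
Proof.
move=> /= F mF tF mUF; rewrite /density_prob; apply: cvg_toP.
  apply: ereal_nondecreasing_is_cvgn => m n mn.
  by apply: lee_sum_nneg_natr => // k _ _; exact: P_ge0.
rewrite ge0_integral_bigcup//=; last by move=> x _; rewrite lee_fin.
exact/measurable_funTS/measurableT_comp.
Qed.

HB.instance Definition _ := isMeasure.Build _ _ _ P P0 P_ge0 P_sigma_additive.

HB.instance Definition _ := @Measure_isProbability.Build _ _ R P g_int.

Let P_dominated : P `<< leb.
Proof.
apply/null_content_dominatesP => A mA A0.
by apply: null_set_integral => //; exact/measurable_funTS/measurableT_comp.
Qed.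

Let g_integrable : leb.-integrable setT (EFin \o g).
Proof.
apply/integrableP; split; first exact/measurableT_comp.
under eq_integral do rewrite /= ger0_norm//.
by rewrite g_int ltry.
Qed.

Let derivative_density :
  ae_eq leb setT (Radon_Nikodym (charge_of_finite_measure P) leb) (EFin \o g).
Proof.
apply: integral_ae_eq => //.
- exact: Radon_Nikodym_integrable.
- exact/measurableT_comp.
- by move=> A _ mA; rewrite -Radon_Nikodym_integral.
Qed.

(** Both g and the Radon-Nikodym derivative integrate to the same measure, so
    they agree almost everywhere. *)
Lemma Rintegral_density (h : measurableTypeR R -> R) (M : R) :
  measurable_fun setT h -> (forall x, `|h x| <= M) ->
  Rintegral P setT h = Rintegral leb setT (fun x => g x * h x).
Proof.
move=> mh hM; rewrite /Rintegral.
have ih := @bounded_integrable R _ _ P h M mh hM.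
rewrite -(Radon_Nikodym_change_of_variables P_dominated measurableT ih).
congr fine; apply: ae_eq_integral => //.
- apply: emeasurable_funM; first exact/measurableT_comp.
  by apply: measurable_int; exact: Radon_Nikodym_integrable.
- by apply/measurableT_comp => //; exact: measurable_funM.
under [in X in ae_eq _ _ _ X]eq_fun do rewrite mulrC EFinM.
exact: ae_eqe_mul2l.
Qed.

Lemma cint_density (f : measurableTypeR R -> R[i]) : bounded_cmeasurable f ->
  cint P f = cint leb (fun x => ((g x)%:C)%C * f x).
Proof.
move=> [[f1 f2] [M fM]]; apply: complexP => /=.
  rewrite (@Rintegral_density _ M)//; last first.
    by move=> x; exact: le_trans (normRe_le _) (fM x).
  by apply: eq_Rintegral => x _; rewrite ReMc.
rewrite (@Rintegral_density _ M)//; last first.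
  by move=> x; exact: le_trans (normIm_le _) (fM x).
by apply: eq_Rintegral => x _; rewrite ImMc.
Qed.

End DensityProbability.

(** * The substitution by a power *)

Section PowerSubstitution.
Context {R : realType}.
Local Notation leb := (@lebesgue_measure R).

Lemma cvg_powR_right0 (p : R) (k : R -> R) : 0 < p -> {for 0, continuous k} ->
  k (u `^ p) @[u --> 0^'+] --> k 0.
Proof. by move=> p0 k0; apply: continuous_cvg => //; exact: powR_cvg0. Qed.

(** The primitive of l (u^(1/s)) is u * k (u^(1/s)). *)
Lemma Rintegral_power_substitution (s : R) (k dk l : R -> R) : 0 < s ->
  (forall t : R, is_derive t 1 k (dk t)) -> continuous l ->
  (forall t, k t + s^-1 * t * dk t = l t) ->
  Rintegral leb `[0, 1] (fun u => l (u `^ s^-1)) = k 1.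
Proof.
move=> s0 kd cl E; have p0 : 0 < s^-1 by rewrite invr_gt0.
have ck : continuous k.
  by move=> t; have [? _] := kd t; exact/differentiable_continuous/derivable1_diffP.
pose F u := u * k (u `^ s^-1).
have Fd (u : R) : 0 < u -> is_derive u 1 F (l (u `^ s^-1)).
  move=> u0; have dp := is_derive1_powR s^-1 u0.
  have dkp : is_derive u 1 (fun u => k (u `^ s^-1))
      (dk (u `^ s^-1) * (s^-1 * u `^ (s^-1 - 1))).
    exact: (@is_derive1_comp R k (fun t => t `^ s^-1)).
  rewrite (_ : F = id * (fun u => k (u `^ s^-1)))//.
  apply: is_derive_eq (is_deriveM (is_derive_id _ _) dkp) _.
  by rewrite -E -(mulr_powRB1 (ltW u0) p0) /GRing.scale /=; ring.
have cF (u : R) : 0 < u -> {for u, continuous F}.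
  move=> /Fd[? _]; exact/differentiable_continuous/derivable1_diffP.
have cp (u : R) : 0 < u -> {for u, continuous (fun u => u `^ s^-1)}.
  move=> /(is_derive1_powR s^-1)[? _].
  exact/differentiable_continuous/derivable1_diffP.
have z0 : (0 : R) `^ s^-1 = 0 by rewrite powR0// gt_eqF.
rewrite /Rintegral (@continuous_FTC2 _ _ F)//.
- by rewrite /F mul0r mul1r powR1 /= subr0.
- apply/continuous_within_itvP => //; split.
  + move=> u; rewrite in_itv/= => /andP[u0 _].
    by apply: (@continuous_comp _ _ _ (fun u => u `^ s^-1) l); [exact: cp|exact: cl].
  + by rewrite z0; exact: cvg_powR_right0 p0 (cl 0).
  + apply: cvg_at_left_filter.
    by apply: (@continuous_comp _ _ _ (fun u => u `^ s^-1) l); [exact: cp|exact: cl].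
- split.
  + by move=> u; rewrite in_itv/= => /andP[u0 _]; have [] := Fd u u0.
  + have : u * k (u `^ s^-1) @[u --> (0 : R)^'+] --> 0 * k 0.
      apply: cvgM; last exact: cvg_powR_right0 p0 (ck 0).
      by apply: (@cvg_at_right_filter _ _ (id : R -> R)); exact: cvg_id.
    by rewrite /F !mul0r.
  + by apply: cvg_at_left_filter; exact: cF.
- move=> u; rewrite in_itv/= => /andP[u0 _].
  by rewrite derive1E; have [_ ->] := Fd u u0.
Qed.

End PowerSubstitution.

(** * Randomised choices and products of transforms *)

Section UniformVariable.
Context {R : realType}.
Local Notation leb := (@lebesgue_measure R).

Definition unit_density (x : measurableTypeR R) : R := \1_(`[0, 1]%classic : set R) x.

Lemma measurable_unit_density : measurable_fun setT unit_density.
Proof. exact: measurable_indic. Qed.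

Lemma unit_density_ge0 x : 0 <= unit_density x.
Proof. by rewrite /unit_density indicE. Qed.

Lemma integral_unit_density (p : R) : 0 <= p <= 1 ->
  (\int[leb]_(x in `]-oo, p]) (unit_density x)%:E = p%:E)%E.
Proof.
move=> /andP[p0 p1]; rewrite integral_indic//.
rewrite (_ : _ `&` _ = `[0, p]%classic); last first.
  apply/seteqP; split=> x /=; rewrite !in_itv/=.
    by move=> [/andP[-> _] ->].
  by move=> /andP[x0 xp]; rewrite x0 xp (le_trans xp).
rewrite /= lebesgue_measure_itv/= lte_fin.
case: ltgtP p0 => // [p0 _|<- _]; last by rewrite ?subr0 ?EFinN.
by rewrite -EFinB subr0.
Qed.

Lemma integral_unit_densityT : (\int[leb]_x (unit_density x)%:E = 1)%E.
Proof.
rewrite integral_indic// setIT /= lebesgue_measure_itv/= lte_fin ltr01.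
by rewrite -EFinB subr0.
Qed.

Definition unif := density_prob measurable_unit_density unit_density_ge0
  integral_unit_densityT.

HB.instance Definition _ := Probability.on unif.

Lemma Rintegral_unif (h : measurableTypeR R -> R) (M : R) :
  measurable_fun setT h -> (forall x, `|h x| <= M) ->
  Rintegral unif setT h = Rintegral leb `[0, 1] h.
Proof.
move=> mh hM; rewrite (Rintegral_density _ _ _ mh hM) [RHS]Rintegral_mkcond.
apply: eq_Rintegral => x _; rewrite /unit_density indicE patchE.
by case: ifPn => _; rewrite ?mul1r ?mul0r.
Qed.

Lemma cint_unif_if (p : R) (a b : R[i]) : 0 <= p <= 1 ->
  cint unif (fun u : measurableTypeR R => if u <= p then a else b) =
  (p%:C)%C * a + ((1 - p)%:C)%C * b.
Proof.
move=> p01.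
pose ind (u : measurableTypeR R) : R := \1_(`]-oo, p]%classic : set R) u.
have mind : measurable_fun setT ind by exact: measurable_indic.
have ind1 u : `|ind u| <= 1 by rewrite /ind indicE; case: (_ \in _); rewrite ?normr1 ?normr0.
have bind : bounded_cmeasurable (fun u => ((ind u)%:C)%C).
  split; first exact: cmeasurable_real.
  by exists 1 => u /=; rewrite expr0n addr0 sqrtr_sqr.
have Iind : cint unif (fun u => ((ind u)%:C)%C) = (p%:C)%C.
  apply: complexP; rewrite /= /Rintegral ?integral0//.
  rewrite integral_indic// setIT.
  exact: (congr1 fine (integral_unit_density p01)).
rewrite (_ : (fun u => _) = fun u => (a - b) * ((ind u)%:C)%C + b); last first.
  apply/funext => u; rewrite /ind indicE.
  case: ifPn => up; first by rewrite mem_set//= ?in_itv//= mulr1 subrK.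
  by rewrite memNset ?mulr0 ?add0r//= in_itv/=; apply/negP.
rewrite cintD ?cint_cst ?cintZ ?Iind//; first last.
- exact: bounded_cmeasurable_cst.
- by apply: bounded_cmeasurableM => //; exact: bounded_cmeasurable_cst.
by rewrite rmorphB rmorph1; ring.
Qed.

End UniformVariable.

Section Transforms.
Context {R : realType}.
Implicit Types (H A : R[i] -> R[i]) (l s : R).

Definition is_transform l H :=
  exists mu : probability (measurableTypeR R) R,
    forall z : R[i], 0 < complex.Im z -> gen_stieltjes l mu z = H z.

(** A uniform variable realises the choice between X and Y with the random
    weight p. *)
Lemma weighted_choice d (T : measurableType d) (P : probability T R)
    (p : T -> R) (X Y : T -> measurableTypeR R) :
  measurable_fun setT p -> measurable_fun setT X -> measurable_fun setT Y ->
  (forall t, 0 <= p t <= 1) ->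
  exists mu : probability (measurableTypeR R) R,
    forall f : measurableTypeR R -> R[i], bounded_cmeasurable f ->
      cint mu f = cint P (fun t =>
        ((p t)%:C)%C * f (X t) + ((1 - p t)%:C)%C * f (Y t)).
Proof.
move=> mp mX mY p01.
pose Z (w : T * measurableTypeR R) := if w.2 <= p w.1 then X w.1 else Y w.1.
have mZ : measurable_fun setT Z.
  apply: measurable_fun_ifT.
  - apply: measurable_fun_ler; first exact: measurable_snd.
    exact: (measurableT_comp mp measurable_fst).
  - exact: (measurableT_comp mX measurable_fst).
  - exact: (measurableT_comp mY measurable_fst).
have [mu muE] := law_exists (P \x unif)%E mZ.
exists mu => f bf; rewrite muE// cint_Fubini; last first.
  exact: bounded_cmeasurable_comp.
congr cint; apply/funext => t /=; rewrite -cint_unif_if//.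
by congr cint; apply/funext => u; rewrite /Z /=; case: ifP.
Qed.

Lemma cint_fst d1 (T1 : measurableType d1) d2 (T2 : measurableType d2)
    (P1 : probability T1 R) (P2 : probability T2 R) (f : T1 -> R[i]) :
  bounded_cmeasurable f -> cint (P1 \x P2)%E (fun t => f t.1) = cint P1 f.
Proof.
move=> bf; rewrite cint_Fubini; last exact: bounded_cmeasurable_comp.
by congr cint; apply/funext => x; rewrite /= cint_cst.
Qed.

Lemma cint_snd d1 (T1 : measurableType d1) d2 (T2 : measurableType d2)
    (P1 : probability T1 R) (P2 : probability T2 R) (f : T2 -> R[i]) :
  bounded_cmeasurable f -> cint (P1 \x P2)%E (fun t => f t.2) = cint P2 f.
Proof.
move=> bf; rewrite cint_Fubini; last exact: bounded_cmeasurable_comp.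
by rewrite /= cint_cst.
Qed.

Lemma is_transform_half l H1 H2 : 0 <= l -> is_transform l H1 ->
  is_transform l H2 -> is_transform l (fun z => (H1 z + H2 z) / 2).
Proof.
move=> l0 [mu1 E1] [mu2 E2].
have h01 : 0 <= (2^-1 : R) <= 1.
  by rewrite invr_ge0 ler0n invf_le1// ler1n.
have [mu muE] := @weighted_choice _ _ (mu1 \x mu2)%E (fun=> 2^-1) fst snd
  (measurable_cst _) measurable_fst measurable_snd (fun=> h01).
exists mu => z z0; rewrite gen_stieltjesE// muE; last exact: bounded_kernel.
have bk := bounded_kernel z0 l0.
have b1 := bounded_cmeasurable_comp
  (@measurable_fst _ _ (measurableTypeR R) (measurableTypeR R)) bk.
have b2 := bounded_cmeasurable_comp
  (@measurable_snd _ _ (measurableTypeR R) (measurableTypeR R)) bk.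
rewrite cintD; first last.
- by apply: bounded_cmeasurableM b2; exact: bounded_cmeasurable_cst.
- by apply: bounded_cmeasurableM b1; exact: bounded_cmeasurable_cst.
rewrite (cintZ _ _ b1) (cintZ _ _ b2) (cint_fst _ _ bk) (cint_snd _ _ bk).
rewrite -!gen_stieltjesE// E1// E2//.
have -> : 1 - 2^-1 = 2^-1 :> R by field.
by rewrite fmorphV rmorph_nat; field.
Qed.

(** With w = z - (a + t (x - a)), the primitive in u = t^s is
    u * w^(-s) / (z - a). *)
Lemma cint_beta_mixture s (z : R[i]) (x a : R) : 0 < s -> 0 < complex.Im z ->
  cint unif (fun u : measurableTypeR R =>
    cpow (z - ((a + u `^ s^-1 * (x - a))%:C)%C) (- (s + 1))) =
  cpow (z - (x%:C)%C) (- s) * cpow (z - (a%:C)%C) (- 1).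
Proof.
move=> s0 z0.
pose y (t : R) := a + t * (x - a).
have dy (t : R) : is_derive t 1 y (x - a).
  have -> : y = cst a + id * cst (x - a) by [].
  apply: is_derive_eq (is_deriveD (is_derive_cst _ _ _)
    (is_deriveM (is_derive_id _ _) (is_derive_cst _ _ _))) _.
  by rewrite /GRing.scale /=; ring.
pose w (t : R) : R[i] := z - ((y t)%:C)%C.
have w0 t : w t != 0 by exact: sub_real_neq0.
pose l (t : R) : R[i] := cpow (w t) (- (s + 1)).
pose k (t : R) : R[i] := cpow (z - (a%:C)%C) (- 1) * cpow (w t) (- s).
pose dk (t : R) : R[i] := cpow (z - (a%:C)%C) (- 1) *
  (((x - a)%:C)%C * (((- s)%:C)%C * - (w t)^-1 * cpow (w t) (- s))).
have kd (t : R) : is_cderive k t (dk t).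
  exact: (is_cderiveZ _
    (is_cderive_comp (is_cderive_cpow (- s) (y t) z0) (dy t))).
have ld (t : R) : is_cderive l t _ :=
  is_cderive_comp (is_cderive_cpow (- (s + 1)) (y t) z0) (dy t).
have [clR clI] := is_cderive_continuous (fun t => ex_intro _ _ (ld t)).
have E t : k t + ((s^-1 * t)%:C)%C * dk t = l t.
  have za0 : z - (a%:C)%C != 0 by exact: sub_real_neq0.
  have sC : (s%:C)%C != 0 :> R[i] by rewrite fmorph_eq0 gt_eqF.
  rewrite /k /dk /l opprD cpowD// !cpowN// !cpow1//.
  have cw := cpow_neq0 s (w0 t).
  have wE : w t = z - (a%:C)%C - (t%:C)%C * ((x%:C)%C - (a%:C)%C).
    by rewrite /w /y rmorphD rmorphM rmorphB; ring.
  rewrite rmorphM rmorphN fmorphV rmorphB.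
  move: (w0 t) cw; set c := cpow _ _; rewrite wE => wn cw; field.
  by rewrite cw sC za0 wn.
have bl := bounded_kernel z0 (ltW (addr_gt0 s0 ltr01)).
have mp : measurable_fun setT (fun u : measurableTypeR R => u `^ s^-1 : R).
  exact: (@measurable_powR R s^-1).
have my : measurable_fun setT
    (fun u : measurableTypeR R => y (u `^ s^-1) : measurableTypeR R).
  exact: (measurable_funD (measurable_cst a)
    (measurable_funM mp (measurable_cst (x - a)))).
have [[mR mI] [M lM]] := bounded_cmeasurable_comp my bl.
have x1 : w 1 = z - (x%:C)%C by rewrite /w /y mul1r [a + _]addrC subrK.
apply: complexP => /=.
  rewrite (@Rintegral_unif R _ M)//; last first.
    by move=> u; exact: le_trans (normRe_le _) (lM u).
  apply: etrans (Rintegral_power_substitution s0 (fun t => (kd t).1) clR _) _.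
    by move=> t; rewrite -E ReD ReMc.
  by rewrite mulrC /k x1.
rewrite (@Rintegral_unif R _ M)//; last first.
  by move=> u; exact: le_trans (normIm_le _) (lM u).
apply: etrans (Rintegral_power_substitution s0 (fun t => (kd t).2) clI _) _.
  by move=> t; rewrite -E ImD ImMc.
by rewrite mulrC /k x1.
Qed.

(** The variable T = U^(1/s), with U uniform, has the Beta(s, 1) law; the measure
    is the law of Y + T (X - Y). *)
Lemma is_transform_mul s H A : 0 < s -> is_transform s H ->
  is_transform 1 A -> is_transform (s + 1) (fun z => H z * A z).
Proof.
move=> s0 [mu muE] [rho rhoE].
pose X (v : (measurableTypeR R * measurableTypeR R) * measurableTypeR R) :=
  v.1.2 + v.2 `^ s^-1 * (v.1.1 - v.1.2) : measurableTypeR R.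
have m12 : measurable_fun setT (fun v : (measurableTypeR R * measurableTypeR R) *
    measurableTypeR R => v.1.2 : R).
  exact: (measurableT_comp measurable_snd measurable_fst).
have m11 : measurable_fun setT (fun v : (measurableTypeR R * measurableTypeR R) *
    measurableTypeR R => v.1.1 : R).
  exact: (measurableT_comp measurable_fst measurable_fst).
have mp : measurable_fun setT (fun u : measurableTypeR R => u `^ s^-1 : R).
  exact: (@measurable_powR R s^-1).
have mX : measurable_fun setT X.
  exact: (measurable_funD m12 (measurable_funM
    (measurableT_comp mp measurable_snd) (measurable_funB m11 m12))).
have [m mE] := law_exists ((mu \x rho) \x unif)%E mX.
exists m => z z0.
have bk := bounded_kernel z0 (ltW (addr_gt0 s0 ltr01)).
have bs := bounded_kernel z0 (ltW s0); have b1 := bounded_kernel z0 ler01.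
rewrite gen_stieltjesE// mE// cint_Fubini; last first.
  exact: (bounded_cmeasurable_comp mX bk).
under [X in cint _ X]funext do rewrite /X /= cint_beta_mixture//.
rewrite cint_Fubini/=; last first.
  apply: bounded_cmeasurableM.
    exact: (bounded_cmeasurable_comp measurable_fst bs).
  exact: (bounded_cmeasurable_comp measurable_snd b1).
under [X in cint mu X]funext do
  rewrite cintZ// -gen_stieltjesE// rhoE// mulrC.
by rewrite cintZ// -gen_stieltjesE// muE// mulrC.
Qed.

End Transforms.

(** * Integrals over the real line *)

Section LineIntegrals.
Context {R : realType}.
Local Notation leb := (@lebesgue_measure R).
Implicit Types s r x : R.

(** In the variable v = e^x, two_sided_exp s x dx is v^(s - 1) dv / (1 + v). *)
Definition two_sided_exp (s x : R) : R := expR (s * x) / (1 + expR x).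

Lemma two_sided_exp_ge0 s x : 0 <= two_sided_exp s x.
Proof. by rewrite divr_ge0 ?expR_ge0// addr_ge0 ?expR_ge0. Qed.

Lemma two_sided_exp_le_left s x : two_sided_exp s x <= expR (s * x).
Proof.
rewrite ler_pdivrMr ?ltr_pwDl ?expR_ge0//.
by rewrite ler_peMr ?expR_ge0// lerDl expR_ge0.
Qed.

Lemma two_sided_exp_le_right s x : two_sided_exp s x <= expR ((s - 1) * x).
Proof.
rewrite ler_pdivrMr ?ltr_pwDl ?expR_ge0// mulrDr mulr1 -expRD.
rewrite (_ : (s - 1) * x + x = s * x); last by ring.
by rewrite lerDr expR_ge0.
Qed.

Lemma continuous_two_sided_exp s : continuous (two_sided_exp s).
Proof.
move=> x; rewrite /continuous_at /two_sided_exp; apply: cvgM.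
  apply: (@continuous_comp _ _ _ (fun x => s * x) expR).
    exact: mulrl_continuous.
  exact: continuous_expR.
apply: cvgV; first by rewrite gt_eqF// ltr_pwDl ?expR_ge0.
by apply: cvgD; [exact: cvg_cst|exact: continuous_expR].
Qed.

Lemma integrable_expR_halfline (r : R) : 0 < r ->
  leb.-integrable `[0, +oo[ (fun x => (expR (- r * x))%:E).
Proof.
move=> r0.
have ip : leb.-integrable `[0, +oo[ (EFin \o exponential_pdf r).
  by apply: integrableS (integrable_exponential_pdf r0).
have mI : measurable (`[0, +oo[%classic : set (measurableTypeR R)) by [].
apply: (eq_integrable mI _ _ _ (integrableZl mI r^-1 ip)).
move=> x; rewrite inE /= => x0; rewrite -EFinM exponential_pdfE.
  by rewrite mulrA mulVf ?mul1r// gt_eqF.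
by move: x0; rewrite in_itv/= andbT.
Qed.

Lemma integrable_two_sided_exp s : 0 < s -> s < 1 ->
  leb.-integrable setT (EFin \o two_sided_exp s).
Proof.
move=> s0 s1; have mk : measurable_fun setT (two_sided_exp s).
  by apply: continuous_measurable_fun; exact: continuous_two_sided_exp.
have mEk : measurable_fun setT (EFin \o two_sided_exp s) by exact/measurable_EFinP.
apply/integrableP; split => //.
under eq_integral do rewrite /= ger0_norm ?two_sided_exp_ge0//.
have lty r (h : R -> R) : 0 < r -> continuous h -> (forall x, 0 <= h x) ->
    (forall x, 0 <= x -> h x <= expR (- r * x)) ->
    (\int[leb]_(x in `[0%R, +oo[) (h x)%:E < +oo)%E.
  move=> r0 ch h0 hle.
  have /integrableP[me] := integrable_expR_halfline r0; apply: le_lt_trans.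
  apply: ge0_le_integral => //=.
  - by move=> x _; rewrite lee_fin.
  - apply: measurable_funTS; apply/measurable_EFinP.
    exact: continuous_measurable_fun.
  - exact: (measurableT_comp (@abse_measurable R setT) me).
  - move=> x; rewrite in_itv/= andbT => x0; rewrite lee_fin ger0_norm ?expR_ge0//.
    exact: hle.
rewrite -(setUv `[0, +oo[%classic) ge0_integral_setU//=; last 4 first.
- exact: measurableC.
- by rewrite setUv.
- by move=> x _; rewrite lee_fin two_sided_exp_ge0.
- exact/disj_setPCl.
apply: lte_add_pinfty.
  apply: (@lty (1 - s)); rewrite ?subr_gt0//.
  - exact: continuous_two_sided_exp.
  - exact: two_sided_exp_ge0.
  - by move=> x _; rewrite opprB; exact: two_sided_exp_le_right.
apply: (@le_lt_trans _ _
    (\int[leb]_(x in `]-oo, (- 0)%R]) (two_sided_exp s x)%:E)%E).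
  apply: ge0_subset_integral => //=.
  - exact: measurableC.
  - exact: measurable_funTS.
  - by move=> x _; rewrite lee_fin two_sided_exp_ge0.
  - by rewrite setCitvr oppr0; apply: subset_itvl; rewrite bnd_simp.
rewrite ge0_integration_by_substitutionNy; last 2 first.
- exact/continuous_subspaceT/continuous_two_sided_exp.
- by move=> x _; exact: two_sided_exp_ge0.
apply: (@lty s) => //.
- move=> x; apply: (@continuous_comp _ _ _ (-%R) (two_sided_exp s)).
    exact: opp_continuous.
  exact: continuous_two_sided_exp.
- by move=> x; exact: two_sided_exp_ge0.
- move=> x _; apply: le_trans (two_sided_exp_le_left _ _) _.
  by rewrite mulrN mulNr.
Qed.

Lemma cvg_expRN_nat (r : R) : 0 < r -> expR (- r * n%:R) @[n --> \oo] --> 0.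
Proof.
move=> r0.
have -> : (fun n : nat => expR (- r * n%:R)) = (fun x => expR (- x)) \o
    (fun n : nat => r * n%:R) by apply/funext => n /=; rewrite mulNr.
apply: (@cvg_comp _ _ _ _ _ _ (pinfty_nbhs R)); last exact: cvgr_expR.
apply: (@cvg_comp _ _ _ (fun n : nat => n%:R) (fun x => r * x) _
  (pinfty_nbhs R)); first exact: cvgr_idn.
by apply: gt0_cvgMry => //; exact: cvg_id.
Qed.

(** The integral over [-n, n] is F n - F (-n), which tends to 0. *)
Lemma Rintegral_derivative_line (F h : R -> R) s (C D : R) :
  0 < s -> s < 1 -> (forall x : R, is_derive x 1 F (h x)) -> continuous h ->
  (forall x, `|F x| <= C * two_sided_exp s x) ->
  (forall x, `|h x| <= D * two_sided_exp s x) ->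
  Rintegral leb setT h = 0.
Proof.
move=> s0 s1 Fd ch FC hD.
have mh : measurable_fun setT h by exact: continuous_measurable_fun.
have iD := integrableZl measurableT D (integrable_two_sided_exp s0 s1).
have ih : leb.-integrable setT (EFin \o h).
  apply: le_integrable iD => //; first exact/measurable_EFinP.
  by move=> x _ /=; rewrite lee_fin; apply: le_trans (hD x) _; exact: ler_norm.
have cF : continuous F.
  by move=> t; have [? _] := Fd t; exact/differentiable_continuous/derivable1_diffP.
pose J (n : nat) : set R := `[- n.+1%:R, n.+1%:R]%classic.
have JE n : (\int[leb]_(x in J n) (h x)%:E = (F n.+1%:R - F (- n.+1%:R))%:E)%E.
  rewrite (@continuous_FTC2 _ _ F) ?EFinB//.
  - by rewrite (@lt_trans _ _ 0)// ?oppr_lt0 ltr0n.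
  - exact: continuous_subspaceT.
  - split; first by move=> x _; have [] := Fd x.
      by apply: cvg_at_right_filter; exact: cF.
    by apply: cvg_at_left_filter; exact: cF.
  - by move=> x _; rewrite derive1E; have [_ ->] := Fd x.
have cvg1 : (\int[leb]_(x in J n) (h x)%:E)%E @[n --> \oo] -->
    (\int[leb]_x (h x)%:E)%E.
  under eq_fun do rewrite integral_mkcond.
  apply: (@dominated_cvg _ _ _ leb setT measurableT
    (fun n x => ((EFin \o h) \_ (J n)) x) (EFin \o h) (EFin \o (fun x => `|h x|))) => //.
  - move=> n; apply/(measurable_restrictT _ _).1 => //.
      exact: measurable_itv.
    exact/measurable_funTS/measurable_EFinP.
  - move=> x _; apply: cvg_near_cst; near=> n.
    rewrite patchE mem_set//; rewrite /J /= in_itv/= -ler_norml.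
    by apply: ltW; rewrite -natr1 ltr_pwDr//; near: n; exact: nbhs_infty_ger.
  - exact: (integrable_abse ih).
  - move=> n x _; rewrite patchE; case: ifP => _ //=.
    by rewrite normr0 lee_fin.
have cvg2 : (\int[leb]_(x in J n) (h x)%:E)%E @[n --> \oo] --> 0%E.
  under eq_fun do rewrite JE.
  apply: cvg_EFin; first exact: nearW.
  have C0 : 0 <= C.
    rewrite -(@pmulr_lge0 _ (two_sided_exp s 0)).
      exact: le_trans (normr_ge0 _) (FC 0).
    by rewrite divr_gt0 ?expR_gt0// ltr_pwDl ?expR_ge0.
  have Fcvg (e : nat -> R) r : 0 < r -> (forall n, `|F (e n)| <= C * expR (- r * n%:R)) ->
      F (e n) @[n --> \oo] --> 0.
    move=> r0 Fe; apply: norm_cvg0; apply: (@squeeze_cvgr _ _ _ _ (cst 0)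
        (fun n => C * expR (- r * n%:R))).
    - by apply: nearW => n; rewrite normr_ge0 Fe.
    - exact: cvg_cst.
    - rewrite -(mulr0 C); apply: cvgM; first exact: cvg_cst.
      exact: cvg_expRN_nat.
  rewrite -(subr0 0); apply: cvgB.
    apply: (Fcvg (fun n => n.+1%:R) (1 - s)) => [|n]; first by rewrite subr_gt0.
    apply: le_trans (FC _) _; apply: ler_wpM2l => //.
    apply: le_trans (two_sided_exp_le_right _ _) _; rewrite ler_expR opprB.
    by rewrite ler_nM2l ?subr_lt0// ler_nat.
  apply: (Fcvg (fun n => - n.+1%:R) s) => // n.
  apply: le_trans (FC _) _; apply: ler_wpM2l => //.
  apply: le_trans (two_sided_exp_le_left _ _) _; rewrite ler_expR mulrN mulNr.
  by rewrite lerN2 ler_pM2l// ler_nat.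
rewrite /Rintegral; suff -> : (\int[leb]_x (h x)%:E)%E = 0%E by [].
by apply: cvg_unique cvg1 cvg2.
Unshelve. all: by end_near. Qed.

End LineIntegrals.

(** * The shift of the contour *)

Section ContourShift.
Context {R : realType}.
Local Notation leb := (@lebesgue_measure R).
Implicit Types (s t x : R) (w L c : R[i]).

Definition logistic_kernel s w : R[i] := cexp ((s%:C)%C * w) / (1 + cexp w).

Definition logistic_kernel' s w : R[i] :=
  ((s%:C)%C - cexp w / (1 + cexp w)) * logistic_kernel s w.

Lemma is_cderive_logistic_kernel s (p : R -> R[i]) t (dp : R[i]) :
  is_cderive p t dp -> 1 + cexp (p t) != 0 ->
  is_cderive (fun t => logistic_kernel s (p t)) t
    (dp * logistic_kernel' s (p t)).
Proof.
move=> pt n0; have de := is_cderive_exp pt.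
have dn := is_cderiveV n0 (is_cderiveD (is_cderive_cst 1 t) de).
apply: is_cderive_eq (is_cderiveM (is_cderive_exp (is_cderiveZ (s%:C)%C pt)) dn) _.
by rewrite /logistic_kernel' /logistic_kernel; field.
Qed.

Lemma ex_cderive_logistic_kernel' s (p : R -> R[i]) t (dp : R[i]) :
  is_cderive p t dp -> 1 + cexp (p t) != 0 ->
  exists d, is_cderive (fun t => logistic_kernel' s (p t)) t d.
Proof.
move=> pt n0; have de := is_cderive_exp pt.
have dn := is_cderiveV n0 (is_cderiveD (is_cderive_cst 1 t) de).
eexists; exact: (is_cderiveM (is_cderiveB (is_cderive_cst (s%:C)%C t)
  (is_cderiveM de dn)) (is_cderive_logistic_kernel s pt n0)).
Qed.

Definition strip_constant (y0 : R) : R := Num.sqrt ((1 + cos y0) / 2).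

Lemma strip_constant_gt0 (y0 : R) : 0 <= y0 < pi -> 0 < strip_constant y0.
Proof.
move=> /andP[y00 y0pi]; rewrite sqrtr_gt0 divr_gt0// -(opprK 1) addrC subr_gt0.
by rewrite -cospi ltr_cos// in_itv/= ?y00 ?pi_ge0 ?lexx ?(ltW y0pi).
Qed.

(** Away from Im w = pi (mod 2 pi), cexp w stays away from -1. *)
Lemma normc_1Dcexp_ge (y0 : R) w : `|complex.Im w| <= y0 < pi ->
  strip_constant y0 * (1 + expR (complex.Re w)) <= Normc.normc (1 + cexp w).
Proof.
move=> /andP[wy y0pi]; have y00 : 0 <= y0 by exact: le_trans (normr_ge0 _) wy.
have k0 : 0 < strip_constant y0 by apply: strip_constant_gt0; rewrite y00.
have cle : cos y0 <= cos (complex.Im w).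
  rewrite -[leRHS]cos_norm leNgt ltr_cos -?leNgt//.
    by rewrite in_itv/= y00 ltW.
  by rewrite in_itv/= normr_ge0 (le_trans wy)// ltW.
have E0 := expR_gt0 (complex.Re w).
rewrite -(@ler_pXn2r _ 2)// ?nnegrE ?normc_ge0 ?mulr_ge0 ?addr_ge0 ?(ltW k0) ?(ltW E0)//.
rewrite exprMn sqr_sqrtr; last first.
  by rewrite divr_ge0// -lerBlDl sub0r cos_geN1.
rewrite normc_sqr ReD ImD /= add0r.
have cs := cos2Dsin2 (complex.Im w).
move: (cos_le1 y0) cs cle E0; move: (cos y0) (cos (complex.Im w)) => c0 c.
move: (sin _) (expR _) => s E c01 cs cle E0.
have -> : (1 + E * c) ^+ 2 + (E * s) ^+ 2 =
    1 + 2 * E * c + E ^+ 2 * (c ^+ 2 + s ^+ 2) by ring.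
rewrite cs mulr1.
(* The difference of the two sides is 2 E (c - c0) + (1 - c0) (1 - E)^2 / 2. *)
have h1 : 0 <= E * (c - c0) by rewrite mulr_ge0 ?subr_ge0 ?(ltW E0).
have h2 : 0 <= (1 - c0) * (1 - E) ^+ 2 by rewrite mulr_ge0 ?subr_ge0 ?sqr_ge0.
by nra.
Qed.

Lemma strip_neq0 (y0 : R) w : `|complex.Im w| <= y0 < pi -> 1 + cexp w != 0.
Proof.
move=> wy; rewrite -normc_gt0; apply: lt_le_trans (normc_1Dcexp_ge wy).
have /andP[wy1 wy2] := wy.
by rewrite mulr_gt0 ?strip_constant_gt0 ?wy2 ?andbT ?(le_trans (normr_ge0 _) wy1).
Qed.

Lemma normc_logistic_kernel_le (y0 s : R) w : `|complex.Im w| <= y0 < pi ->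
  Normc.normc (logistic_kernel s w) <=
  (strip_constant y0)^-1 * two_sided_exp s (complex.Re w).
Proof.
move=> wy; have /andP[wy1 wy2] := wy.
have k0 : 0 < strip_constant y0.
  by apply: strip_constant_gt0; rewrite (le_trans (normr_ge0 _) wy1).
have p0 : 0 < 1 + expR (complex.Re w) by rewrite ltr_pwDl ?expR_ge0.
rewrite /logistic_kernel Normc.normcM Normc.normcV normc_cexp ReMc.
rewrite /two_sided_exp mulrCA -invfM ler_wpM2l ?expR_ge0//.
rewrite lef_pV2 ?posrE ?mulr_gt0 ?normc_gt0 ?(strip_neq0 wy)//.
exact: normc_1Dcexp_ge.
Qed.

Lemma normc_logistic_kernel'_le (y0 s : R) w : 0 <= s ->
  `|complex.Im w| <= y0 < pi ->
  Normc.normc (logistic_kernel' s w) <= (s + (strip_constant y0)^-1) *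
    ((strip_constant y0)^-1 * two_sided_exp s (complex.Re w)).
Proof.
move=> s0 wy; have /andP[wy1 wy2] := wy.
have k0 : 0 < strip_constant y0.
  by apply: strip_constant_gt0; rewrite (le_trans (normr_ge0 _) wy1).
have p0 : 0 < 1 + expR (complex.Re w) by rewrite ltr_pwDl ?expR_ge0.
rewrite /logistic_kernel' Normc.normcM ler_pM ?normc_ge0//; last first.
  exact: normc_logistic_kernel_le.
apply: le_trans (@le_normcD R (s%:C)%C (- (cexp w / (1 + cexp w)))) _.
rewrite (@normcN R (cexp w / (1 + cexp w))) Normc.normcM Normc.normcV normc_cexp.
apply: lerD; first by rewrite /= expr0n addr0 sqrtr_sqr ger0_norm.
rewrite ler_pdivrMr ?normc_gt0 ?(strip_neq0 wy)// -ler_pdivrMl ?invr_gt0// invrK.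
apply: le_trans (normc_1Dcexp_ge wy); rewrite ler_wpM2l ?(ltW k0)//.
by rewrite lerDr.
Qed.

Lemma two_sided_exp_shift (s a A x : R) : 0 <= s <= 1 -> `|a| <= A ->
  two_sided_exp s (x - a) <= expR (2 * A) * two_sided_exp s x.
Proof.
move=> /andP[s0 s1] aA; have A0 := le_trans (normr_ge0 _) aA.
move: aA; rewrite ler_norml => /andP[aA1 aA2].
have p0 y : 0 < 1 + expR y :> R by rewrite ltr_pwDl ?expR_ge0.
rewrite /two_sided_exp mulrA ler_pdivlMr// mulrAC ler_pdivrMr//.
have h1 : expR (s * (x - a)) <= expR A * expR (s * x).
  rewrite -expRD ler_expR mulrBr addrC lerD2r.
  by rewrite -mulrN (le_trans (y := s * A))// ?ler_wpM2l// ?ler_piMl//; lra.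
have h2 : 1 + expR x <= expR A * (1 + expR (x - a)).
  rewrite mulrDr mulr1 -expRD lerD//; first by rewrite -expR0 ler_expR.
  by rewrite ler_expR; lra.
apply: le_trans (ler_pM (expR_ge0 _) (ltW (p0 x)) h1 h2) _.
have -> : expR (2 * A) = expR A * expR A by rewrite -expRD; congr expR; ring.
by rewrite le_eqVlt; apply/orP; left; apply/eqP; ring.
Qed.

Lemma is_cderive_line L t x :
  is_cderive (fun x => (x%:C)%C - (t%:C)%C * L) x 1.
Proof.
apply: is_cderive_eq (is_cderiveB (is_cderive_real (is_derive_id x 1))
  (is_cderive_cst _ _)) _.
by rewrite subr0 rmorph1.
Qed.

Lemma is_cderive_shift L t x :
  is_cderive (fun t => (x%:C)%C - (t%:C)%C * L) t (- L).
Proof.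
apply: is_cderive_eq (is_cderiveB (is_cderive_cst _ _)
  (is_cderiveM (is_cderive_real (is_derive_id t 1)) (is_cderive_cst L _))) _.
by rewrite rmorph1 mul1r mulr0 addr0 sub0r.
Qed.

Lemma is_cderive_ReM c f x (df : R[i]) : is_cderive f x df ->
  is_derive x 1 (fun t => complex.Re (c * f t)) (complex.Re (c * df)).
Proof. by move=> /(is_cderiveZ c)[]. Qed.

Lemma normReM_le c w : `|complex.Re (c * w)| <= Normc.normc c * Normc.normc w.
Proof. by rewrite -Normc.normcM; exact: normRe_le. Qed.

(** Differentiating in t under the integral gives the integral over the line of
    -L times an x-derivative, which vanishes.  The factor c gives access to the
    imaginary part as well. *)
Lemma Rintegral_contour_shift s L c : 0 < s -> s < 1 -> `|complex.Im L| < pi ->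
  Rintegral leb setT (fun x => complex.Re (c * logistic_kernel s ((x%:C)%C - L))) =
  Rintegral leb setT (fun x => complex.Re (c * logistic_kernel s (x%:C)%C)).
Proof.
move=> s0 s1 Lpi; have pi0 : 0 < pi :> R := pi_gt0 R.
pose phi := `|complex.Im L|; pose y0 := (phi + pi) / 2.
pose b : R := 1 + (pi - phi) / (2 * pi).
have phi0 : 0 <= phi by exact: normr_ge0.
have phipi : phi < pi by exact: Lpi.
have y0pi : y0 < pi by rewrite /y0; lra.
have b1 : 1 < b by rewrite ltrDl divr_gt0 ?mulr_gt0 ?subr_gt0.
have b2 : b <= 2.
  rewrite -[leRHS]/(1 + 1) lerD2l ler_pdivrMr ?mulr_gt0// mul1r; lra.
(* For -b < t < b, x - t L stays in the strip |Im w| <= y0 with y0 < pi; the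
   interval ]-b, b[ contains [0, 1] in its interior. *)
have bphi : b * phi <= y0.
  rewrite /b mulrDl mul1r mulrAC -lerBrDl ler_pdivrMr ?mulr_gt0// /y0.
  have : 0 <= (pi - phi) * (pi - phi) by rewrite mulr_ge0 ?subr_ge0 ?(ltW phipi).
  by move: (pi : R) (phi) => P q; nra.
pose k := strip_constant y0.
have k0 : 0 < k by apply: strip_constant_gt0; rewrite y0pi andbT /y0; lra.
pose A := 2 * `|complex.Re L|.
pose C := k^-1 * expR (2 * A).
pose p t x : R[i] := (x%:C)%C - (t%:C)%C * L.
have pIm t x : -b < t < b -> `|complex.Im (p t x)| <= y0 < pi.
  rewrite -ltr_norml => tb; rewrite y0pi andbT /p ImD ImN ImMc /= sub0r normrN normrM.
  by apply: le_trans bphi; rewrite ler_wpM2r// ltW.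
have pRe t x : -b < t < b ->
    two_sided_exp s (complex.Re (p t x)) <= expR (2 * A) * two_sided_exp s x.
  rewrite -ltr_norml => tb; rewrite /p ReD ReN ReMc /=.
  apply: two_sided_exp_shift; first by rewrite !ltW.
  by rewrite normrM ler_wpM2r// (le_trans (ltW tb)).
have kle t x : -b < t < b ->
    Normc.normc (logistic_kernel s (p t x)) <= C * two_sided_exp s x.
  move=> tb; apply: le_trans (normc_logistic_kernel_le s (pIm t x tb)) _.
  by rewrite -mulrA ler_wpM2l ?invr_ge0 ?(ltW k0)// pRe.
have k'le t x : -b < t < b -> Normc.normc (logistic_kernel' s (p t x)) <=
    (s + k^-1) * C * two_sided_exp s x.
  move=> tb; apply: le_trans (normc_logistic_kernel'_le (ltW s0) (pIm t x tb)) _.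
  rewrite -!mulrA ler_wpM2l ?addr_ge0 ?invr_ge0 ?(ltW k0) ?(ltW s0)//.
  by rewrite ler_wpM2l ?invr_ge0 ?(ltW k0)// pRe.
have pn0 t x : -b < t < b -> 1 + cexp (p t x) != 0.
  by move=> tb; exact: strip_neq0 (pIm t x tb).
pose f (t : R) (x : measurableTypeR R) : R := complex.Re (c * logistic_kernel s (p t x)).
have dft t x : -b < t < b -> is_derive t 1 (f ^~ x)
    (complex.Re (c * (- L * logistic_kernel' s (p t x)))).
  move=> tb; apply: is_cderive_ReM.
  apply: (@is_cderive_logistic_kernel s (fun t => p t x)); last exact: pn0.
  exact: is_cderive_shift.
have dfx t x (d : R[i]) : -b < t < b -> is_derive x 1
    (fun x => complex.Re (d * logistic_kernel s (p t x)))
    (complex.Re (d * logistic_kernel' s (p t x))).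
  move=> tb; apply: is_cderive_ReM; rewrite -[X in is_cderive _ _ X]mul1r.
  apply: (@is_cderive_logistic_kernel s (p t)); last exact: pn0.
  exact: is_cderive_line.
have cf' t (d : R[i]) : -b < t < b ->
    continuous (fun x => complex.Re (d * logistic_kernel' s (p t x))).
  move=> tb; have H x : exists e, is_cderive
      (fun x => d * logistic_kernel' s (p t x)) x e.
    have [e he] := ex_cderive_logistic_kernel' s (is_cderive_line L t x) (pn0 t x tb).
    by exists (d * e); exact: is_cderiveZ.
  exact: (is_cderive_continuous H).1.
have ik (M : R) : leb.-integrable setT (EFin \o (fun x => M * two_sided_exp s x)).
  exact: (integrableZl measurableT M (integrable_two_sided_exp s0 s1)).
have intf t : `]-b, b[%classic t -> leb.-integrable setT (EFin \o f t).
  rewrite /= in_itv/= => tb.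
  apply: le_integrable (ik (Normc.normc c * C)) => //.
    apply/measurable_EFinP; apply: continuous_measurable_fun => x.
    have [? _] := dfx t x c tb.
    exact/differentiable_continuous/derivable1_diffP.
  move=> x _ /=; rewrite lee_fin; apply: le_trans (normReM_le _ _) _.
  apply: le_trans (ler_norm _); rewrite -mulrA ler_wpM2l ?normc_ge0//.
  exact: kle.
pose G (x : measurableTypeR R) : R := Normc.normc (c * L) * ((s + k^-1) * C) * two_sided_exp s x.
have C0 : 0 <= C by rewrite mulr_ge0 ?invr_ge0 ?expR_ge0 ?(ltW k0).
have G0 x : 0 <= G x.
  apply: mulr_ge0; last exact: two_sided_exp_ge0.
  apply: mulr_ge0; first exact: normc_ge0.
  by apply: mulr_ge0 => //; rewrite addr_ge0 ?invr_ge0 ?ltW.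
have fd t x : `]-b, b[%classic t -> setT x -> derivable (f ^~ x) t 1.
  by rewrite /= in_itv/= => tb _; have [] := dft t x tb.
have d1E t x : `]-b, b[%classic t -> partial1of2 f t x =
    complex.Re (- (c * L) * logistic_kernel' s (p t x)).
  rewrite /= in_itv/= => tb; rewrite partial1of2E.
  by have [_ ->] := dft t x tb; congr complex.Re; ring.
have Gub t x : `]-b, b[%classic t -> setT x -> `|partial1of2 f t x| <= G x.
  move=> tb _; rewrite d1E//; apply: le_trans (normReM_le _ _) _.
  rewrite (@normcN R (c * L)) /G -mulrA ler_wpM2l ?normc_ge0//.
  by apply: k'le; move: tb; rewrite /= in_itv.
pose K t := Rintegral leb setT (f t).
have dK t : `]-b, b[%classic t -> is_derive t 1 K 0.
  move=> tb; apply: DeriveDef.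
    exact: (@derivable_under_integral _ _ _ leb f setT (@measurableT _ (measurableTypeR R)) t (- b) b tb
      intf fd G G0 (ik _) Gub).
  rewrite -derive1E (@differentiation_under_integral _ _ _ leb f setT
    (@measurableT _ (measurableTypeR R)) t (- b) b tb intf fd G G0 (ik _) Gub).
  under eq_Rintegral do rewrite d1E//.
  move: tb; rewrite /= in_itv/= => tb.
  apply: (@Rintegral_derivative_line R
    (fun x => complex.Re (- (c * L) * logistic_kernel s (p t x))) _ s
    (Normc.normc (- (c * L)) * C) (Normc.normc (- (c * L)) * ((s + k^-1) * C))) => //.
  - by move=> x; exact: dfx.
  - exact: cf'.
  - move=> x; apply: le_trans (normReM_le _ _) _; rewrite -mulrA.
    by rewrite ler_wpM2l ?normc_ge0// kle.
  - move=> x; apply: le_trans (normReM_le _ _) _; rewrite -mulrA.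
    by rewrite ler_wpM2l ?normc_ge0// k'le.
have K10 : K 1 = K 0.
  have I01 t : t \in `[0, 1] -> `]-b, b[%classic t.
    by rewrite /= !in_itv/= => /andP[t0 t1]; apply/andP; split; lra.
  have dK' t : t \in `]0, 1[ -> is_derive t 1 K ((fun=> 0) t).
    by move=> t01; apply/dK/I01; exact: subset_itv_oo_cc.
  have cK : {within `[0, 1], continuous K}.
    by apply: derivable_within_continuous => t /I01/dK[].
  have [t _ /eqP] := MVT ltr01 dK' cK.
  by rewrite mul0r subr_eq0 => /eqP.
move: K10; rewrite /K /f /p.
under eq_Rintegral do rewrite rmorph1 mul1r.
by under [X in _ = X]eq_Rintegral do rewrite rmorph0 mul0r subr0.
Qed.

End ContourShift.

(** * Powers as integrals over the real line *)

Section PowerRepresentation.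
Context {R : realType}.
Local Notation leb := (@lebesgue_measure R).
Implicit Types (s x : R) (z : R[i]).

Definition two_sided_mass s : R := Rintegral leb setT (two_sided_exp s).

Lemma two_sided_mass_gt0 s : 0 < s -> s < 1 -> 0 < two_sided_mass s.
Proof.
move=> s0 s1; have c0 : 0 < (1 + expR 1)^-1 :> R.
  by rewrite invr_gt0 ltr_pwDl ?expR_ge0.
have ik := integrable_two_sided_exp s0 s1.
have mI : measurable (`[0, 1]%classic : set (measurableTypeR R)) by [].
rewrite /two_sided_mass -lte_fin fineK; last exact: integrable_fin_num ik.
apply: (@lt_le_trans _ _ (\int[leb]_(x in `[0%R, 1%R]) ((1 + expR 1)^-1)%:E)%E).
  rewrite integral_cst//= lebesgue_measure_itv/= lte_fin ltr01.
  by rewrite -EFinB subr0 mule1 lte_fin.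
apply: (@le_trans _ _ (\int[leb]_(x in `[0%R, 1%R]) (two_sided_exp s x)%:E)%E).
  apply: ge0_le_integral => //=.
  - by apply: measurable_funTS; exact: measurable_int ik.
  - move=> x; rewrite in_itv/= => /andP[x0 x1]; rewrite lee_fin.
    rewrite -[leLHS]mul1r ler_pM ?invr_ge0 ?addr_ge0 ?expR_ge0//.
      by rewrite -expR0 ler_expR mulr_ge0// ltW.
    by rewrite lef_pV2 ?posrE ?ltr_pwDl ?expR_ge0// lerD2l ler_expR.
apply: ge0_subset_integral => //=.
- exact: measurable_int ik.
- by move=> x _; rewrite lee_fin two_sided_exp_ge0.
Qed.

Definition two_sided_density s (x : measurableTypeR R) : R :=
  (two_sided_mass s)^-1 * two_sided_exp s x.

Lemma two_sided_probability s : 0 < s -> s < 1 ->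
  exists P : probability (measurableTypeR R) R,
    forall f : measurableTypeR R -> R[i], bounded_cmeasurable f ->
      cint P f = cint leb (fun x => ((two_sided_density s x)%:C)%C * f x).
Proof.
move=> s0 s1; have M0 := two_sided_mass_gt0 s0 s1.
have ik := integrable_two_sided_exp s0 s1.
have mg : measurable_fun setT (two_sided_density s).
  apply: measurable_funM => //.
  by apply: continuous_measurable_fun; exact: continuous_two_sided_exp.
have g0 x : 0 <= two_sided_density s x.
  by rewrite mulr_ge0 ?two_sided_exp_ge0 ?invr_ge0 ?ltW.
have g1 : (\int[leb]_x (two_sided_density s x)%:E = 1)%E.
  under eq_integral do rewrite EFinM.
  rewrite (integralZl measurableT ik) -[X in (_ * X)%E]fineK; last first.
    exact: integrable_fin_num ik.
  by rewrite -EFinM mulVf// gt_eqF.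
exists (density_prob mg g0 g1) => f bf; exact: cint_density.
Qed.

(** Substituting w = x - clog eta turns e^(s x) / (e^x + eta) into
    eta^(s - 1) times the logistic kernel, and the contour shift removes eta. *)
Lemma cint_power s (d eta : R[i]) : 0 < s -> s < 1 -> eta != 0 ->
  `|carg eta| < pi ->
  cint leb (fun x : measurableTypeR R =>
    d * (((expR (s * x))%:C)%C / (((expR x)%:C)%C + eta))) =
  ((two_sided_mass s)%:C)%C * (d * cpow eta (s - 1)).
Proof.
move=> s0 s1 eta0 etapi; set c := cpow eta (s - 1); pose L := clog eta.
have fE x : ((expR (s * x))%:C)%C / (((expR x)%:C)%C + eta) =
    c * logistic_kernel s ((x%:C)%C - L).
  have Le : cexp L = eta by exact: clogK.
  rewrite /logistic_kernel mulrBr !cexpB -rmorphM /= !cexp_real Le.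
  rewrite /c cpowD// cpowN// cpow1// cpowE// -/L.
  have cs := cexp_neq0 ((s%:C)%C * L).
  have [e0|e0] := eqVneq (((expR x)%:C)%C + eta) 0.
    rewrite (_ : 1 + ((expR x)%:C)%C / eta = (((expR x)%:C)%C + eta) / eta).
      by rewrite e0 mul0r !invr0 !mulr0.
    by field.
  by field; rewrite eta0 cs andbT addrC; exact: e0.
have kE x : logistic_kernel s ((x%:C)%C) = ((two_sided_exp s x)%:C)%C.
  rewrite /logistic_kernel -rmorphM /= !cexp_real /two_sided_exp.
  by rewrite rmorphM fmorphV rmorphD rmorph1.
have main (b : R[i]) : Rintegral leb setT (fun x : measurableTypeR R =>
    complex.Re (b * (((expR (s * x))%:C)%C / (((expR x)%:C)%C + eta)))) =
    two_sided_mass s * complex.Re (b * c).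
  under eq_Rintegral do rewrite fE mulrA.
  rewrite (@Rintegral_contour_shift R s L (b * c) s0 s1 etapi).
  under eq_Rintegral do rewrite kE mulrC ReMc mulrC.
  rewrite RintegralZl//; last exact: integrable_two_sided_exp.
  by rewrite mulrC.
have ImE z : complex.Im z = complex.Re (- 'i%C * z).
  by case: z => a b; rewrite ReM /=; ring.
apply: complexP => /=; first by rewrite ReMc main.
rewrite ImMc ImE mulrA -main.
by apply: eq_Rintegral => x _; rewrite ImE; congr complex.Re; ring.
Qed.

End PowerRepresentation.

(** * The symmetric Bernoulli law and the existence of the measure *)

Section Bernoulli.
Context {R : realType}.

(** Adding a constant reduces to nonnegative functions. *)
Lemma Rintegral_sym_bernoulli (h : measurableTypeR R -> R) (M : R) :
  measurable_fun setT h -> (forall x, `|h x| <= M) ->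
  Rintegral (sym_bernoulli R) setT h = (h (-1) + h 1) / 2.
Proof.
move=> mh hM; have M0 := le_trans (normr_ge0 _) (hM 0).
have ih : (sym_bernoulli R).-integrable setT (EFin \o h).
  exact: (@bounded_integrable R _ _ (sym_bernoulli R) h M).
have iM : (sym_bernoulli R).-integrable setT (EFin \o (fun=> M)).
  by apply: (@bounded_integrable R _ _ (sym_bernoulli R) _ M) => // x; rewrite ger0_norm.
have mM : measurable_fun setT (fun x => (h x + M)%:E).
  by apply/measurable_EFinP; exact: measurable_funD.
have hM0 x : (0 <= (h x + M)%:E)%E.
  by rewrite lee_fin -lerBlDr sub0r; have := hM x; rewrite ler_norml => /andP[].
have E : Rintegral (sym_bernoulli R) setT (fun x => h x + M) =
    ((h (-1) + M) + (h 1 + M)) / 2.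
  rewrite /Rintegral /sym_bernoulli ge0_integral_mscale// ge0_integral_measure_add//.
  by rewrite !integral_dirac// !diracT !mul1e -EFinD -EFinM /= mulrC.
move: E; rewrite RintegralD// (Rintegral_prob_cst (sym_bernoulli R)) => E.
by apply: (addIr M); rewrite E; field.
Qed.

Lemma cint_sym_bernoulli (f : measurableTypeR R -> R[i]) :
  bounded_cmeasurable f -> cint (sym_bernoulli R) f = (f (-1) + f 1) / 2.
Proof.
move=> [[f1 f2] [M fM]].
have E (z : R[i]) : z / 2 = ((2^-1)%:C)%C * z by rewrite fmorphV rmorph_nat mulrC.
apply: complexP; rewrite E ?ReMc ?ImMc ?ReD ?ImD /= mulrC.
  rewrite (@Rintegral_sym_bernoulli _ M)// => x.
  exact: le_trans (normRe_le _) (fM x).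
rewrite (@Rintegral_sym_bernoulli _ M)// => x.
exact: le_trans (normIm_le _) (fM x).
Qed.

Lemma stieltjes_sym_bernoulli (z : R[i]) : 0 < complex.Im z ->
  stieltjes (sym_bernoulli R) z = z / (z ^+ 2 - 1).
Proof.
move=> z0; rewrite stieltjesE// cint_sym_bernoulli; last exact: bounded_kernel.
have n1 := sub_real_neq0 (-1) z0; have n2 := sub_real_neq0 1 z0.
rewrite !cpowN ?cpow1//.
rewrite rmorphN rmorph1 opprK in n1 *; rewrite rmorph1 in n2 *.
have -> : z ^+ 2 - 1 = (z + 1) * (z - 1) by ring.
by field; rewrite n1 n2.
Qed.

End Bernoulli.

Section Sufficiency.
Context {R : realType}.
Implicit Types (s l : R) (z : R[i]) (H : R[i] -> R[i]).

Lemma is_transform_ext l H1 H2 :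
  (forall z, 0 < complex.Im z -> H1 z = H2 z) ->
  is_transform l H1 -> is_transform l H2.
Proof. by move=> E [mu muE]; exists mu => z z0; rewrite muE// E. Qed.

Lemma is_transform_dirac l (e : R) : 0 <= l ->
  is_transform l (fun z => cpow (z - (e%:C)%C) (- l)).
Proof.
move=> l0; have [mu muE] := law_exists (@unif R)
  (@measurable_cst _ _ _ _ setT (e : measurableTypeR R)).
exists mu => z z0; rewrite gen_stieltjesE// muE; last exact: bounded_kernel.
by rewrite /= cint_cst.
Qed.

(** With v distributed as v^(s-1) dv / (1 + v) up to a constant and
    t = 1 / (1 + v), the representation
    eta^(s-1) = E [(1 + v) / (v + eta)] at eta = (z + e) / z reads
    E [z / (z + e t)], and the partial fraction
      z / ((z + e t) (z - e)) = [1 / (z - e) + t / (z + e t)] / (1 + t)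
    has positive weights. *)
Lemma is_transform_power s (e : R) : 0 < s -> s < 1 -> e ^+ 2 = 1 ->
  is_transform 1 (fun z => cpow (z / (z + (e%:C)%C)) (1 - s) / (z - (e%:C)%C)).
Proof.
move=> s0 s1 e2; have [P PE] := two_sided_probability s0 s1.
have M0 := two_sided_mass_gt0 s0 s1.
pose t (x : measurableTypeR R) : R := (1 + expR x)^-1.
have v0 x : 0 < 1 + expR x :> R by rewrite ltr_pwDl ?expR_ge0.
have t0 x : 0 < t x by rewrite invr_gt0.
have mt : measurable_fun setT t.
  apply: continuous_measurable_fun => x; apply: cvgV; first by rewrite gt_eqF.
  by apply: cvgD; [exact: cvg_cst|exact: continuous_expR].
pose p (x : measurableTypeR R) : R := (1 + t x)^-1.
have mp : measurable_fun setT p.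
  apply: continuous_measurable_fun => x; apply: cvgV.
    by rewrite gt_eqF// addr_gt0.
  apply: cvgD; first exact: cvg_cst.
  apply: cvgV; first by rewrite gt_eqF.
  by apply: cvgD; [exact: cvg_cst|exact: continuous_expR].
have p01 x : 0 <= p x <= 1.
  by rewrite invr_ge0 addr_ge0 ?(ltW (t0 x))//= invf_le1 ?addr_gt0// lerDl ltW.
pose Y (x : measurableTypeR R) : measurableTypeR R := - e * t x.
have mY : measurable_fun setT Y by apply: measurable_funM.
have [mu muE] := weighted_choice P mp
  (@measurable_cst _ _ _ _ setT (e : measurableTypeR R)) mY p01.
exists mu => z z0.
have bk := bounded_kernel z0 (@ler01 R).
rewrite gen_stieltjesE// muE//.
have zn := upper_neq0 z0; have zen := sub_real_neq0 e z0.
have ze0 : 0 < complex.Im (z + (e%:C)%C) by rewrite ImD /= addr0.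
have zpe := upper_neq0 ze0.
have e2C : (e%:C)%C ^+ 2 = 1 :> R[i] by rewrite -rmorphXn e2 rmorph1.
have kY x : z - ((Y x)%:C)%C != 0 by exact: sub_real_neq0.
have YE x : z - ((Y x)%:C)%C = z + (e%:C)%C * ((t x)%:C)%C.
  by rewrite /Y rmorphM rmorphN mulNr opprK.
have -> : (fun x => ((p x)%:C)%C * cpow (z - (e%:C)%C) (- 1) +
      ((1 - p x)%:C)%C * cpow (z - ((Y x)%:C)%C) (- 1)) =
    (fun x => (z - (e%:C)%C)^-1 * (z * cpow (z - ((Y x)%:C)%C) (- 1))).
  apply/funext => x; rewrite !cpowN// !cpow1//.
  have tn : 1 + ((t x)%:C)%C != 0 :> R[i].
    by rewrite -(rmorph1 (real_complex R)) -rmorphD fmorph_eq0 gt_eqF// addr_gt0.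
  rewrite /p rmorphB rmorph1 fmorphV rmorphD rmorph1.
  have := kY x; rewrite YE => kYx.
  by field; rewrite tn zen kYx.
have bY := bounded_cmeasurable_comp mY bk.
have bzY := bounded_cmeasurableM (bounded_cmeasurable_cst (measurableTypeR R) z) bY.
rewrite (cintZ _ _ bzY) mulrC; congr (_ / _).
pose eta := (z + (e%:C)%C) / z.
have eta0 : eta != 0 by rewrite mulf_neq0 ?invr_eq0.
have ceta : `|carg eta| < pi.
  have -> : carg eta = carg (z + (e%:C)%C) - carg z.
    exact: (congr1 (@complex.Im R) (clog_div ze0 z0)).
  rewrite ltr_norml.
  by move: (carg_upper z0) (carg_upper ze0) => /andP[? ?] /andP[? ?]; lra.
have -> : cpow (z / (z + (e%:C)%C)) (1 - s) = cpow eta (s - 1).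
  by rewrite -[s - 1]opprB cpowN// !cpow_div// invf_div.
pose m := ((two_sided_mass s)%:C)%C : R[i].
have m0 : m != 0 by rewrite fmorph_eq0 gt_eqF.
rewrite (PE _ bzY).
have -> : (fun x => ((two_sided_density s x)%:C)%C *
      (z * cpow (z - ((Y x)%:C)%C) (- 1))) =
    (fun x => m^-1 * (((expR (s * x))%:C)%C / (((expR x)%:C)%C + eta))).
  apply/funext => x; rewrite /two_sided_density rmorphM fmorphV -mulrA -/m.
  congr (_ * _); rewrite /two_sided_exp cpowN// cpow1//.
  have vn : 1 + ((expR x)%:C)%C != 0 :> R[i].
    by rewrite -(rmorph1 (real_complex R)) -rmorphD fmorph_eq0 gt_eqF.
  have := kY x; rewrite YE /t fmorphV rmorphD rmorph1 => kYx.
  rewrite rmorphM fmorphV rmorphD rmorph1 /eta.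
  have vz : ((expR x)%:C)%C + (z + (e%:C)%C) / z != 0.
    rewrite (_ : _ + _ = (1 + ((expR x)%:C)%C) *
        (z + (e%:C)%C * (1 + ((expR x)%:C)%C)^-1) / z); last first.
      by field; rewrite zn vn.
    by rewrite !mulf_neq0 ?invr_eq0.
  have vz' : ((expR x)%:C)%C * z + (z + (e%:C)%C) != 0.
    by rewrite -[z + _ in X in X != 0](divfK zn) -mulrDl mulf_neq0.
  field.
  by apply/and3P; split; [exact: zn|exact: vz'|exact: vn].
by rewrite cint_power// mulrA mulfV// mul1r.
Qed.

(** As z, z + 1, z - 1 and z / (z + 1) = 1 - 1 / (z + 1) all lie in the upper
    half plane, the logarithms subtract without branch correction. *)
Lemma cpow_transform s z : 0 < complex.Im z ->
  cpow (z / (z ^+ 2 - 1)) s = cpow z s / (cpow (z + 1) s * cpow (z - 1) s).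
Proof.
move=> z0; have z1 : 0 < complex.Im (z + 1) by rewrite ImD /= addr0.
have zm1 : 0 < complex.Im (z - 1) by rewrite ImD ImN /= subr0.
have [n0 n1 nm1] := And3 (upper_neq0 z0) (upper_neq0 z1) (upper_neq0 zm1).
have zz1 : 0 < complex.Im (z / (z + 1)).
  rewrite (_ : z / (z + 1) = 1 - (z + 1)^-1); last by field.
  rewrite ImD ImN ImV /= add0r mulNr opprK divr_gt0// exprn_gt0//.
  by rewrite normc_gt0.
have -> : z / (z ^+ 2 - 1) = z / (z + 1) / (z - 1).
  have -> : z ^+ 2 - 1 = (z + 1) * (z - 1) by ring.
  by rewrite invfM mulrA.
by rewrite !cpow_div// invfM mulrA.
Qed.

Lemma upper_transform_neq0 z : 0 < complex.Im z -> z / (z ^+ 2 - 1) != 0.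
Proof.
move=> z0; have z1 : 0 < complex.Im (z + 1) by rewrite ImD /= addr0.
have zm1 : 0 < complex.Im (z - 1) by rewrite ImD ImN /= subr0.
have -> : z ^+ 2 - 1 = (z + 1) * (z - 1) by ring.
by rewrite mulf_neq0 ?invr_eq0 ?mulf_neq0// upper_neq0.
Qed.

(** (z / (z^2 - 1))^(1 + s) is the mean over e = 1, -1 of
    (z - e)^(-s) * (z / (z + e))^s / (z - e). *)
Lemma is_transform_base s : 0 < s -> s < 1 ->
  is_transform (s + 1) (fun z => cpow (z / (z ^+ 2 - 1)) (s + 1)).
Proof.
move=> s0 s1.
have q0 : 0 < 1 - s by lra.
have q1 : 1 - s < 1 by lra.
have piece (e : R) (e2 : e ^+ 2 = 1) := is_transform_mul s0
  (is_transform_dirac e (ltW s0)) (is_transform_power q0 q1 e2).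
have := is_transform_half (addr_ge0 (ltW s0) ler01) (piece 1 (expr1n _ _))
  (piece (-1) (etrans (sqrrN 1) (expr1n _ _))).
have -> : 1 - (1 - s) = s by ring.
apply: is_transform_ext => z z0.
have z1 : 0 < complex.Im (z + 1) by rewrite ImD /= addr0.
have zm1 : 0 < complex.Im (z - 1) by rewrite ImD ImN /= subr0.
have [n0 n1 nm1] := And3 (upper_neq0 z0) (upper_neq0 z1) (upper_neq0 zm1).
have nF := upper_transform_neq0 z0.
rewrite rmorphN rmorph1 opprK !cpowN// (cpow_div _ z0 z1) (cpow_div _ z0 zm1).
rewrite cpowD// cpow1// cpow_transform//.
have [c0 c1 cm1] := And3 (cpow_neq0 s n0) (cpow_neq0 s n1) (cpow_neq0 s nm1).
have -> : z ^+ 2 - 1 = (z + 1) * (z - 1) by ring.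
by field; rewrite ?n1 ?nm1 ?c1 ?cm1.
Qed.

Lemma is_transform_1 : is_transform 1 (fun z => z / (z ^+ 2 - 1)).
Proof.
exists (sym_bernoulli R) => z z0.
by rewrite gen_stieltjesE// -stieltjesE// stieltjes_sym_bernoulli.
Qed.

Lemma is_transform_ge1 l : 1 <= l ->
  is_transform l (fun z => cpow (z / (z ^+ 2 - 1)) l).
Proof.
suff H n k : 1 <= k -> k < n.+2%:R ->
    is_transform k (fun z => cpow (z / (z ^+ 2 - 1)) k).
  move=> l1; apply: (H (Num.bound l)) => //.
  have := archi_boundP (le_trans ler01 l1); move/lt_trans; apply.
  by rewrite ltr_nat.
elim: n k => [|n IH] k k1 kn.
  have [->|kn1] := eqVneq k 1.
    apply: is_transform_ext is_transform_1 => z z0.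
    by rewrite cpow1// upper_transform_neq0.
  have k0 : 0 < k - 1 by rewrite subr_gt0 lt_def kn1.
  have := @is_transform_base (k - 1) k0; rewrite subrK; apply.
  by rewrite ltrBlDr.
have [kn2|kn2] := ltP k n.+2%:R; first exact: IH.
have k2 : 2 <= k by apply: le_trans kn2; rewrite ler_nat.
have h1 : 1 <= k - 1 by lra.
have h2 : k - 1 < n.+2%:R by rewrite ltrBlDr natr1.
have := is_transform_mul (lt_le_trans ltr01 h1) (IH _ h1 h2) is_transform_1.
rewrite subrK; apply: is_transform_ext => z z0.
have nF := upper_transform_neq0 z0.
by rewrite -[in RHS](subrK 1 k) [RHS]cpowD// (cpow1 nF).
Qed.

End Sufficiency.

Unset Implicit Arguments.

Theorem mainTheorem4 (R : realType) (lambda : R) (lambda_gt0 : 0 < lambda) :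
  (forall z : R[i], 0 < complex.Im z ->
     stieltjes (sym_bernoulli R) z = z / (z ^+ 2 - 1)) /\
  ((exists mu : probability (measurableTypeR R) R,
      forall z : R[i], 0 < complex.Im z ->
        gen_stieltjes lambda mu z = cpow (z / (z ^+ 2 - 1)) lambda)
   <-> 1 <= lambda).
Proof.
split; first exact: stieltjes_sym_bernoulli.
split; last exact: is_transform_ge1.
by move=> [mu muE]; exact: transform_exponent_ge1 lambda_gt0 muE.
Qed.
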